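(* Consider the SPDHG iterates $z^k=(x^k,y^k)$ described in the context. For every $(x^\star,y^\star)\in\mathcal{Z}^\star$, set $\Delta^0=V_1(x^0-x^\star,y^1-y^\star)$. Then $$\mathbb{E}\left[V_k(x^{k-1}-x^\star,y^k-y^\star)\right]\le \Delta^0\quad\text{for all }k\ge 1,\qquad \sum_{k=1}^{\infty}\mathbb{E}\left[V(z^k-z^{k-1})\right]\le\Delta^0 .$$ Moreover, almost surely, there exists $(x^\star,y^\star)\in\mathcal{Z}^\star$ (possibly depending on the realization) such that $(x^k,y^k)\to(x^\star,y^\star)$ as $k\to\infty$.
   Context: **Problem.** $\mathcal{X},\mathcal{Y}_1,\dots,\mathcal{Y}_n$ are Euclidean spaces, $\mathcal{Y}=\prod_{i=1}^n\mathcal{Y}_i$, $\mathcal{Z}=\mathcal{X}\times\mathcal{Y}$, $z=(x,y)$. $A_i:\mathcal{X}\to\mathcal{Y}_i$ are linear, $Ax=(A_1x,\dots,A_nx)$, $A^\top$ is the adjoint of $A$. The problem is $\min_{x\in\mathcal{X}}\sum_{i=1}^n f_i(A_ix)+g(x)$, with $f(y)=\sum_i f_i(y_i)$. Standing assumptions: $f_i:\mathcal{Y}_i\to\mathbb{R}\cup\{+\infty\}$ and $g:\mathcal{X}\to\mathbb{R}\cup\{+\infty\}$ are proper, lower semicontinuous, convex; the problem has at least one minimizer; and $0\in\mathrm{ri}(\mathrm{dom} f-A\,\mathrm{dom} g)$. $h^\ast$ is the Fenchel conjugate of $h$, so $f^\ast(y)=\sum_i f_i^\ast(y_i)$. $\mathcal{Z}^\star$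 is the set of primal-dual solutions: $(x^\star,y^\star)\in\mathcal{Z}$ with $0\in A^\top y^\star+\partial g(x^\star)$ and $0\in Ax^\star-\partial f^\ast(y^\star)$. **Norms.** For $\tau>0$, $\|x\|^2_{\tau^{-1}}=\tau^{-1}\|x\|^2$. For positive weights $w_1,\dots,w_n$, $\|y\|_w^2=\sum_i w_i\|y_i\|^2$; $\sigma^{-1}P^{-1}$ denotes the weights $\sigma_i^{-1}p_i^{-1}$. $P^{\pm1}$ acts on $\mathcal{Y}$ by $(P^{\pm1}y)_i=p_i^{\pm1}y_i$. **Algorithm (SPDHG).** Probabilities $p_i>0$, $\sum_i p_i=1$; step sizes $\tau>0$, $\sigma_i>0$ satisfying $p_i^{-1}\tau\sigma_i\|A_i\|^2\le\gamma^2<1$ for all $i$, for some $\gamma\in[0,1)$. $\mathrm{prox}_{t,h}(x)=\arg\min_u h(u)+\frac{1}{2t}\|u-x\|^2$. Start from deterministic $x^0\in\mathcal{X}$, $y^0=y^1=\bar y^1\in\mathcal{Y}$. For $k=1,2,\dots$: $x^k=\mathrm{prox}_{\tau,g}(x^{k-1}-\tau A^\top\bar y^k)$; draw $i_k\in\{1,\dots,n\}$ independently of the past with $\Pr(i_k=i)=p_i$; $y^{k+1}_{i_k}=\mathrm{prox}_{\sigma_{i_k},f^\ast_{i_k}}(y^k_{i_k}+\sigma_{i_k}A_{i_k}x^k)$ and $y^{k+1}_i=y^k_i$ for $i\ne i_k$; $\bar y^{k+1}=y^{k+1}+P^{-1}(y^{k+1}-y^k)$. **Functions.** For $z=(x,y)\in\mathcal{Z}$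 and $k\ge1$, $$V(z)=\tfrac12\|x\|^2_{\tau^{-1}}+\tfrac12\|y\|^2_{\sigma^{-1}P^{-1}}+\langle Ax,P^{-1}y\rangle,$$ $$V_k(x,y)=\tfrac12\|x\|^2_{\tau^{-1}}-\langle Ax,P^{-1}(y^k-y^{k-1})\rangle+\tfrac12\|y^k-y^{k-1}\|^2_{\sigma^{-1}P^{-1}}+\tfrac12\|y\|^2_{\sigma^{-1}P^{-1}}.$$ *)

(* Defs.v *)
From HB Require Import structures.
From mathcomp Require Export all_boot all_order all_algebra.
From mathcomp Require Export all_classical all_reals all_analysis.
Export Order.TTheory GRing.Theory Num.Theory.
Export numFieldNormedType.Exports.

Set Implicit Arguments.
Unset Strict Implicit.
Unset Printing Implicit Defensive.

Local Open Scope classical_set_scope.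
Local Open Scope ring_scope.

(* Euclidean spaces are the coordinate spaces 'cV[R]_d with the standard inner
   product.  The norm that the library puts on matrices is the sup norm, so the
   Euclidean norm and its operator norm are introduced here.  The library
   topology on 'cV[R]_d is the entrywise one, i.e. the Euclidean topology. *)
Section Euclidean.
Context {R : realType}.

Definition dot d (u v : 'cV[R]_d) : R := \sum_i u i 0 * v i 0.

Definition enorm d (u : 'cV[R]_d) : R := Num.sqrt (dot u u).

Definition opnorm k d (M : 'M[R]_(k, d)) : R :=
  sup [set enorm (M *m u) | u in [set u : 'cV[R]_d | enorm u <= 1]].

End Euclidean.

Section ConvexAnalysis.
Context {R : realType} {d : nat}.
Implicit Types (h : 'cV[R]_d -> \bar R) (S : set 'cV[R]_d) (x u v : 'cV[R]_d).

Definition edom h : set 'cV[R]_d := [set x | (h x < +oo)%E].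

Definition proper_fun h := edom h !=set0 /\ (forall x, h x != -oo%E).

(* The convention 0 * +oo = 0 of \bar R makes the endpoints t = 0, 1 harmless. *)
Definition convex_efun h := forall x u (t : R), 0 <= t -> t <= 1 ->
  (h (t *: x + (1 - t) *: u)%R
     <= t%:E * h x + (1 - t)%R%:E * h u)%E.

Definition conjugate h v : \bar R :=
  ereal_sup [set ((dot x v)%:E - h x)%E | x in [set: 'cV[R]_d]].

Definition subdiff h x : set 'cV[R]_d :=
  [set v | forall u, (h x + (dot v (u - x)%R)%:E <= h u)%E].

Definition affine_hull S : set 'cV[R]_d :=
  [set x | exists (k : nat) (c : 'I_k -> R) (u : 'I_k -> 'cV[R]_d),
     [/\ forall j, S (u j), \sum_j c j = 1 & x = \sum_j c j *: u j]].

Definition relint S : set 'cV[R]_d :=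
  [set x | S x /\ exists2 U, nbhs x U & U `&` affine_hull S `<=` S].

Definition prox_obj (t : R) h x u : \bar R :=
  (h u + ((2 * t)^-1 * enorm (u - x) ^+ 2)%R%:E)%E.

(* The minimizer exists and is unique when 0 < t and h is proper, lower
   semicontinuous and convex; the default value 0 is then never used. *)
Definition prox (t : R) h x : 'cV[R]_d :=
  xget 0 [set u | forall v, (prox_obj t h x u <= prox_obj t h x v)%E].

End ConvexAnalysis.

(* The product of the spaces 'cV[R]_(m i) is represented by block column
   vectors: y : 'cV[R]_(\sum_i m i) has components submxcol y i, and the operator
   x |-> (A_1 x, ..., A_n x) is the block matrix \mxcol_i A i. *)
Section Problem.
Context {R : realType} {n d : nat} {m : 'I_n -> nat}.
Local Notation X := 'cV[R]_d.
Local Notation Y := 'cV[R]_(\sum_i m i).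
Variables (f : forall i, 'cV[R]_(m i) -> \bar R) (g : X -> \bar R).
Variable A : forall i, 'M[R]_(m i, d).

Definition opA : 'M[R]_(\sum_i m i, d) := \mxcol_i A i.

Definition sumf (y : Y) : \bar R := (\sum_i f (submxcol y i))%E.

Definition primal_obj (x : X) : \bar R := (\sum_i f (A i *m x)%R + g x)%E.

Definition dom_diff : set Y :=
  [set u - opA *m v | u in edom sumf & v in edom g].

Definition primal_dual_sol : set (X * Y) :=
  [set z | [set opA^T *m z.2 + v | v in subdiff g z.1] 0 /\
           [set opA *m z.1 - v | v in subdiff (conjugate sumf) z.2] 0].

End Problem.

Section Algorithm.
Context {R : realType} {n d : nat} {m : 'I_n -> nat}.
Local Notation X := 'cV[R]_d.
Local Notation Y := 'cV[R]_(\sum_i m i).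
Variables (f : forall i, 'cV[R]_(m i) -> \bar R) (g : X -> \bar R).
Variable A : forall i, 'M[R]_(m i, d).
Variables (p sigma : 'I_n -> R) (tau : R).

Definition invP (y : Y) : Y := \mxcol_i ((p i)^-1 *: submxcol y i).

Definition wnorm2 (w : 'I_n -> R) (y : Y) : R :=
  \sum_i w i * enorm (submxcol y i) ^+ 2.

Definition wsp (i : 'I_n) : R := (sigma i)^-1 * (p i)^-1.

Definition V (x : X) (y : Y) : R :=
  2^-1 * (tau^-1 * enorm x ^+ 2) + 2^-1 * wnorm2 wsp y
  + dot (opA A *m x) (invP y).

(* Vk yk yk1 is the function V_k of the k-th iteration, for y^k = yk and
   y^(k-1) = yk1. *)
Definition Vk (yk yk1 : Y) (x : X) (y : Y) : R :=
  2^-1 * (tau^-1 * enorm x ^+ 2) - dot (opA A *m x) (invP (yk - yk1))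
  + 2^-1 * wnorm2 wsp (yk - yk1) + 2^-1 * wnorm2 wsp y.

(* One realization of SPDHG, driven by the drawn indices s 1, s 2, ...;
   s 0 and ybar 0 play no role. *)
Definition spdhg_run (x0 : X) (y0 : Y) (s : nat -> 'I_n)
    (x : nat -> X) (y ybar : nat -> Y) : Prop :=
  [/\ x 0%N = x0, y 0%N = y0, y 1%N = y0, ybar 1%N = y0 &
   forall k, (0 < k)%N ->
   [/\ x k = prox tau g (x k.-1 - tau *: ((opA A)^T *m ybar k)),
       submxcol (y k.+1) (s k) =
         prox (sigma (s k)) (conjugate (@f (s k)))
           (submxcol (y k) (s k) + sigma (s k) *: (A (s k) *m x k)),
       forall i, i != s k -> submxcol (y k.+1) i = submxcol (y k) i &
       ybar k.+1 = y k.+1 + invP (y k.+1 - y k)]].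

End Algorithm.

Section Sampling.
Context {R : realType} {n : nat} {disp : measure_display}.
Context {Omega : measurableType disp}.

Definition draw_event (s : nat -> Omega -> 'I_n) (k : nat) (j : 'I_n) :
  set Omega := [set w | s k w = j].

Definition past (s : nat -> Omega -> 'I_n) (k : nat) : set (set Omega) :=
  <<s [set E | exists l j, (0 < l < k)%N /\ E = draw_event s l j] >>.

Definition sampling (P : probability Omega R) (p : 'I_n -> R)
    (s : nat -> Omega -> 'I_n) : Prop :=
  forall k j, (0 < k)%N ->
  [/\ measurable (draw_event s k j), P (draw_event s k j) = (p j)%:E &
      forall E, past s k E ->
        P (E `&` draw_event s k j) = (P E * P (draw_event s k j))%E].

End Sampling.

(* Main.v *)
Require Import Defs.
From mathcomp Require Import ring lra.

Set Implicit Arguments.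
Unset Strict Implicit.
Unset Printing Implicit Defensive.

Local Open Scope classical_set_scope.
Local Open Scope ring_scope.

(** Monotonicity of the subdifferentials at the prox points gives the one-step
   estimate [E_k V_(k+1) <= V_k - V (z^k - z^(k-1))]; as [y^k - y^(k-1)] has a
   single nonzero block, the step size condition makes [V_k] and [V]
   nonnegative, and telescoping yields the first two claims.  Everything random
   is a function of finitely many draws, so conditional expectations are finite
   averages over the next draw.

   For the almost sure convergence, subtracting part of
   [|| y^k - y^(k-1) ||^2] from [V_k] gives a nonnegative supermartingale whose
   decrement controls [x^k - x^(k-1)] and the full dual update.  By Ville's
   inequality it is bounded and its decrements are summable, almost surely;
   hence cluster points exist and are primal-dual solutions.  In place of the
   supermartingale convergence theorem, Ville's inequality is applied once more,
   with the solution frozen at the first time when the process centred at some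
   solution is at most [delta]: afterwards this process stays below [lam] except
   with probability [delta / lam].  As such times exist for every [delta], the
   iterates almost surely form a Cauchy sequence.

   A primal-dual solution exists by the relative interior condition: a convex
   function has a subgradient at a relative interior point of its domain, which
   is proved by extending a linear minorant one coordinate at a time. *)

(** * Euclidean spaces *)

Section EuclideanSpace.
Context {R : realType}.

Lemma dotE d (u v : 'cV[R]_d) : dot u v = (u^T *m v) 0 0.
Proof. by rewrite mxE; apply: eq_bigr => i _; rewrite mxE. Qed.

Lemma dotC d (u v : 'cV[R]_d) : dot u v = dot v u.
Proof. by apply: eq_bigr => i _; rewrite mulrC. Qed.

Lemma dotDl d (u v w : 'cV[R]_d) : dot (u + v) w = dot u w + dot v w.
Proof. by rewrite !dotE linearD mulmxDl mxE. Qed.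

Lemma dotDr d (u v w : 'cV[R]_d) : dot w (u + v) = dot w u + dot w v.
Proof. by rewrite !dotE mulmxDr mxE. Qed.

Lemma dotZl d a (u v : 'cV[R]_d) : dot (a *: u) v = a * dot u v.
Proof. by rewrite !dotE linearZ -scalemxAl mxE. Qed.

Lemma dotZr d a (u v : 'cV[R]_d) : dot u (a *: v) = a * dot u v.
Proof. by rewrite dotC dotZl dotC. Qed.

Lemma dotNl d (u v : 'cV[R]_d) : dot (- u) v = - dot u v.
Proof. by rewrite -scaleN1r dotZl mulN1r. Qed.

Lemma dotNr d (u v : 'cV[R]_d) : dot u (- v) = - dot u v.
Proof. by rewrite dotC dotNl dotC. Qed.

Lemma dot0l d (u : 'cV[R]_d) : dot 0 u = 0.
Proof. by rewrite -(scale0r 0) dotZl mul0r. Qed.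

Lemma dot0r d (u : 'cV[R]_d) : dot u 0 = 0.
Proof. by rewrite dotC dot0l. Qed.

Definition dot_linear := (dotDl, dotDr, dotNl, dotNr, dotZl, dotZr, dot0l, dot0r).

Lemma dot_mulmxl k d (M : 'M[R]_(k, d)) u v :
  dot (M *m u) v = dot u (M^T *m v).
Proof. by rewrite !dotE trmx_mul mulmxA. Qed.

Lemma dot_ge0 d (u : 'cV[R]_d) : 0 <= dot u u.
Proof. by apply: sumr_ge0 => i _; rewrite -expr2 sqr_ge0. Qed.

Lemma enorm_ge0 d (u : 'cV[R]_d) : 0 <= enorm u.
Proof. exact: sqrtr_ge0. Qed.

Lemma enorm_sqr d (u : 'cV[R]_d) : enorm u ^+ 2 = dot u u.
Proof. by rewrite sqr_sqrtr ?dot_ge0. Qed.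

Lemma enorm0 d : enorm (0 : 'cV[R]_d) = 0.
Proof. by rewrite /enorm dot0l sqrtr0. Qed.

Lemma enormZ d a (u : 'cV[R]_d) : enorm (a *: u) = `|a| * enorm u.
Proof.
by rewrite /enorm dotZl dotZr mulrA -expr2 sqrtrM ?sqr_ge0// sqrtr_sqr.
Qed.

Lemma enormN d (u : 'cV[R]_d) : enorm (- u) = enorm u.
Proof. by rewrite -scaleN1r enormZ normrN1 mul1r. Qed.

Lemma enormBC d (u v : 'cV[R]_d) : enorm (u - v) = enorm (v - u).
Proof. by rewrite -enormN opprB. Qed.

Lemma entry_le_enorm d (u : 'cV[R]_d) i : `|u i 0| <= enorm u.
Proof.
rewrite -sqrtr_sqr ler_sqrt ?dot_ge0// /dot (bigD1 i)//= expr2 lerDl.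
by apply: sumr_ge0 => j _; rewrite -expr2 sqr_ge0.
Qed.

Lemma enorm_eq0 d (u : 'cV[R]_d) : enorm u = 0 -> u = 0.
Proof.
move=> u0; apply/colP => i; rewrite mxE; apply/normr0_eq0/eqP.
by rewrite eq_le normr_ge0 -u0 entry_le_enorm.
Qed.

(** The square norm of [dot v v *: u - dot u v *: v] is [dot v v] times the Gram determinant of [u]
    and [v]. *)
Lemma cauchy_schwarz d (u v : 'cV[R]_d) : dot u v <= enorm u * enorm v.
Proof.
have [/enorm_eq0 ->|v0] := eqVneq (enorm v) 0.
  by rewrite dot0r mulr_ge0 ?enorm_ge0.
have vv : 0 < dot v v by rewrite -enorm_sqr exprn_gt0// lt_neqAle eq_sym v0 enorm_ge0.
have := dot_ge0 (dot v v *: u - dot u v *: v).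
rewrite !dot_linear (dotC v u) => H.
have : 0 <= dot v v * (dot u u * dot v v - dot u v ^+ 2) by move: H; lra.
rewrite pmulr_rge0// subr_ge0 => uv2.
apply: le_trans (ler_norm _) _.
by rewrite -sqrtr_sqr /enorm -sqrtrM ?dot_ge0// ler_sqrt// mulr_ge0 ?dot_ge0.
Qed.

Lemma abs_dot_le d (u v : 'cV[R]_d) : `|dot u v| <= enorm u * enorm v.
Proof.
rewrite ler_norml cauchy_schwarz andbT lerNl -dotNl.
by rewrite (le_trans (cauchy_schwarz _ _))// enormN.
Qed.

Lemma enormD d (u v : 'cV[R]_d) : enorm (u + v) <= enorm u + enorm v.
Proof.
rewrite -(@ler_pXn2r _ 2)// ?nnegrE ?addr_ge0 ?enorm_ge0//.
rewrite enorm_sqr !dot_linear sqrrD !enorm_sqr (dotC v u).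
by have := cauchy_schwarz u v; lra.
Qed.

Lemma enorm_triangle d (v u w : 'cV[R]_d) :
  enorm (u - w) <= enorm (u - v) + enorm (v - w).
Proof. by rewrite (le_trans _ (enormD _ _))// addrA subrK. Qed.

(** Cauchy-Schwarz on each row gives the Frobenius norm as a bound; it shows that the supremum in
    [opnorm] is over a bounded set. *)
Lemma enorm_bounded_image k d (M : 'M[R]_(k, d)) :
  exists2 B, 0 <= B & forall u, enorm (M *m u) <= B * enorm u.
Proof.
exists (Num.sqrt (\sum_i enorm (row i M)^T ^+ 2)); first exact: sqrtr_ge0.
move=> u; rewrite -(@ler_pXn2r _ 2)// ?nnegrE ?mulr_ge0 ?sqrtr_ge0//.
rewrite [leLHS]enorm_sqr exprMn sqr_sqrtr; last first.
  by apply: sumr_ge0 => i _; exact: sqr_ge0.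
rewrite /dot mulr_suml ler_sum// => i _.
have -> : (M *m u) i 0 = dot (row i M)^T u.
  by rewrite mxE; apply: eq_bigr => j _; rewrite !mxE.
rewrite -expr2 -exprMn -real_normK ?num_real//.
by rewrite lerXn2r ?nnegrE ?mulr_ge0 ?enorm_ge0// abs_dot_le.
Qed.

Lemma le_opnorm k d (M : 'M[R]_(k, d)) u : enorm (M *m u) <= opnorm M * enorm u.
Proof.
have [B B0 MB] := enorm_bounded_image M.
have [/enorm_eq0 ->|u0] := eqVneq (enorm u) 0.
  by rewrite mulmx0 !enorm0 mulr0.
have up : 0 < enorm u by rewrite lt_neqAle eq_sym u0 enorm_ge0.
rewrite -ler_pdivrMr//.
have -> : enorm (M *m u) / enorm u = enorm (M *m ((enorm u)^-1 *: u)).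
  by rewrite -scalemxAr enormZ ger0_norm ?invr_ge0 ?enorm_ge0// mulrC.
apply: ub_le_sup.
  exists B => _ [v /= v1 <-]; rewrite (le_trans (MB v))//.
  by rewrite -[leRHS]mulr1 ler_wpM2l.
exists ((enorm u)^-1 *: u) => //=.
by rewrite enormZ ger0_norm ?invr_ge0 ?enorm_ge0// mulVf.
Qed.

Lemma opnorm_ge0 k d (M : 'M[R]_(k, d)) : 0 <= opnorm M.
Proof.
have [B B0 MB] := enorm_bounded_image M.
rewrite -[leLHS](enorm0 k) -(mulmx0 _ M); apply: ub_le_sup.
  exists B => _ [v /= v1 <-]; rewrite (le_trans (MB v))//.
  by rewrite -[leRHS]mulr1 ler_wpM2l.
by exists 0; rewrite //= enorm0.
Qed.

Lemma nbhs_enorm d (x : 'cV[R]_d) (U : set 'cV[R]_d) : nbhs x U ->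
  exists2 e, 0 < e & forall u, enorm (u - x) < e -> U u.
Proof.
move=> /nbhs_ballP[e /= e0 xU]; exists e => // u ux; apply: xU; split=> // i j.
rewrite ord1 /ball/= (le_lt_trans _ ux)//.
by rewrite -enormN opprB (le_trans _ (entry_le_enorm _ i))// !mxE.
Qed.

Lemma cvg_enorm d (u : nat -> 'cV[R]_d) v :
  (forall e, 0 < e -> exists N, forall k, (N <= k)%N -> enorm (u k - v) < e) ->
  u @ \oo --> v.
Proof.
move=> uv U /nbhs_enorm[e /uv[N Nu] xU]; exists N => // k /= Nk.
exact/xU/Nu.
Qed.

Lemma enorm_le_entries d (u : 'cV[R]_d) e : 0 <= e -> (forall i, `|u i 0| <= e) ->
  enorm u <= d%:R * e.
Proof.
move=> e0 ue; rewrite -(@ler_pXn2r _ 2)// ?nnegrE ?mulr_ge0 ?enorm_ge0//.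
rewrite enorm_sqr /dot (@le_trans _ _ (\sum_(i < d) e ^+ 2))//.
  apply: ler_sum => i _.
  by rewrite -expr2 -real_normK ?num_real// lerXn2r ?nnegrE.
rewrite sumr_const card_ord exprMn -[X in X <= _]mulr_natl ler_wpM2r ?sqr_ge0//.
by rewrite -natrX ler_nat; case: d {u ue} => // d; rewrite -mulnn leq_pmulr.
Qed.

(** The transposes lie in a compact box of row vectors; a cluster point there is approached along
    every tail of the sequence. *)
Lemma bolzano_weierstrass d (u : nat -> 'cV[R]_d) M :
  (forall k, enorm (u k) <= M) ->
  exists v, forall e N, 0 < e -> exists2 k, (N <= k)%N & enorm (u k - v) < e.
Proof.
move=> uM.
have cK : compact [set v : 'rV[R]_d | forall i, `[- M, M]%classic (v ord0 i)].
  by apply: (@rV_compact _ _ (fun=> `[- M, M]%classic)) => _; exact: segment_compact.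
have [|v [_ vcl]] := cK ((fun k => (u k)^T) @ \oo) _ _.
  exists 0%N => // k _ i /=; rewrite in_itv/= mxE -ler_norml.
  exact: le_trans (entry_le_enorm _ _) (uM k).
(* Entries within [e'] give a Euclidean distance of at most [d * e'], which is less than [e]. *)
exists v^T => e N e0; pose e' := e / d.+1%:R.
have e'0 : 0 < e' by rewrite divr_gt0.
have [|_ [[k /= Nk <-] vk]] := vcl [set (u k)^T | k in [set k | (N <= k)%N]] _
    _ (nbhsx_ballx v e' e'0).
  by exists N => // k /= Nk; exists k.
exists k => //; have /le_lt_trans : enorm (u k - v^T) <= d%:R * e'.
  apply: enorm_le_entries (ltW _) _ => // i; rewrite !mxE.
  by have [_ /(_ 0 i)] := vk; rewrite /ball/= mxE distrC => /ltW.
by apply; rewrite /e' mulrCA gtr_pMr// ltr_pdivrMr// mul1r ltr_nat.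
Qed.

End EuclideanSpace.

(** * Convex functions, proximal points and conjugates *)

Section ConvexFunctions.
Context {R : realType}.

Definition lsc_enorm d (h : 'cV[R]_d -> \bar R) := forall x a, (a%:E < h x)%E ->
  exists2 e, 0 < e & forall u, enorm (u - x) < e -> (a%:E < h u)%E.

Lemma lower_semicontinuous_enorm d (h : 'cV[R]_d -> \bar R) :
  lower_semicontinuous h -> lsc_enorm h.
Proof. by move=> hl x a /hl[U /nbhs_enorm[e e0 xU] Uh]; exists e => // u /xU/Uh. Qed.

Definition closed_proper_convex d (h : 'cV[R]_d -> \bar R) :=
  [/\ proper_fun h, lsc_enorm h & convex_efun h].

Lemma proper_fin d (h : 'cV[R]_d -> \bar R) x b :
  proper_fun h -> (h x <= b%:E)%E -> exists2 a, h x = a%:E & a <= b.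
Proof.
by case=> _ /(_ x); case: (h x) => [a| |]//= _ ab; exists a.
Qed.

Lemma convex_le d (h : 'cV[R]_d -> \bar R) x u a b t : convex_efun h ->
  (h x <= a%:E)%E -> (h u <= b%:E)%E -> 0 <= t -> t <= 1 ->
  (h (t *: x + (1 - t) *: u)%R <= (t * a + (1 - t) * b)%:E)%E.
Proof.
move=> hc xa ub t0 t1; apply: le_trans (hc _ _ _ t0 t1) _.
by rewrite [leRHS]EFinD !EFinM leeD// lee_wpmul2l// lee_fin ?subr_ge0.
Qed.

Lemma convex_efun_fin d (h : 'cV[R]_d -> \bar R) : (forall x, h x != -oo%E) ->
  (forall x u a b t, h x = a%:E -> h u = b%:E -> 0 < t -> t < 1 ->
    (h (t *: x + (1 - t) *: u)%R <= (t * a + (1 - t) * b)%:E)%E) ->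
  convex_efun h.
Proof.
move=> hN hc x u t; rewrite le_eqVlt => /predU1P[<- _|t0].
  by rewrite scale0r add0r subr0 scale1r mul0e add0e mul1e.
rewrite le_eqVlt => /predU1P[->|t1].
  by rewrite subrr scale0r addr0 scale1r mul0e adde0 mul1e.
move: (hN x) (hN u); case Ex: (h x) => [a| |]//; case Eu: (h u) => [b| |]// _ _.
- by rewrite -!EFinM -EFinD hc.
- by rewrite [((1 - t)%:E * +oo)%E]gt0_muley ?lte_fin ?subr_gt0// addey ?leey.
- by rewrite gt0_muley ?lte_fin// addye ?leey.
- rewrite [(t%:E * +oo)%E]gt0_muley ?lte_fin// gt0_muley ?lte_fin ?subr_gt0//.
  by rewrite addye ?leey.
Qed.

Lemma ereal_between (a : R) (y : \bar R) : (a%:E < y)%E ->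
  exists2 b, a < b & (b%:E < y)%E.
Proof.
case: y => [y| |]//; rewrite ?lte_fin => ay.
  by exists ((a + y) / 2); rewrite ?lte_fin; lra.
by exists (a + 1); rewrite ?ltry// ltrDl.
Qed.

(* Local boundedness below near a point of the domain propagates along rays by
   convexity, with linear decay. *)
Lemma norm_minorant d (h : 'cV[R]_d -> \bar R) : closed_proper_convex h ->
  exists x0 a r, 0 < r /\
    forall u b, (h u <= b%:E)%E -> a - r * enorm (u - x0) <= b.
Proof.
case=> hp hl hc; have [x0 hx0] := hp.1.
have [a ha _] : exists2 a, h x0 = a%:E & a <= fine (h x0).
  apply: proper_fin => //; rewrite fineK// fin_numE (hp.2 x0)/=.
  by move: hx0; rewrite /edom/=; case: (h x0).
have [|e e0 he] := hl x0 (a - 1); first by rewrite ha lte_fin; lra.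
exists x0, (a - 1), (e / 2)^-1; split=> [|u b ub]; first by rewrite invr_gt0; lra.
have r0 : 0 <= (e / 2)^-1 by rewrite invr_ge0; lra.
have [ue|eu] := ltP (enorm (u - x0)) e.
  have := lt_le_trans (he _ ue) ub; rewrite lte_fin.
  by have := mulr_ge0 r0 (enorm_ge0 (u - x0)); lra.
have ux0 : 0 < enorm (u - x0) by apply: lt_le_trans eu.
(* The point of the segment from [x0] to [u] at distance [e / 2] from [x0] lies in the ball where
   [h] exceeds [a - 1]. *)
pose t := e / 2 / enorm (u - x0).
have t0 : 0 < t by rewrite divr_gt0//; lra.
have t1 : t <= 1 by rewrite ler_pdivrMr// mul1r; lra.
have := @convex_le _ h u x0 b a t hc ub _ (ltW t0) t1; rewrite ha lexx => /(_ isT).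
have -> : t *: u + (1 - t) *: x0 = x0 + t *: (u - x0).
  by rewrite scalerBl scale1r scalerBr addrCA.
have /he/lt_le_trans/[apply] : enorm (x0 + t *: (u - x0) - x0) < e.
  by rewrite addrC addKr enormZ gtr0_norm// /t divfK ?gt_eqF//; lra.
rewrite lte_fin => ab.
have {}ab : - t^-1 < b - a.
  by rewrite -(ltr_pM2l t0) mulrN divff ?gt_eqF//; lra.
have : t^-1 = (e / 2)^-1 * enorm (u - x0) by rewrite /t invf_div mulrC.
by move: ab => /[swap] ->; lra.
Qed.

(** Completing the square absorbs the linear decay into half of the quadratic term; the other half
    bounds the minimizing sequences of [prox_obj]. *)
Lemma quadratic_minorant d (h : 'cV[R]_d -> \bar R) c x : 0 < c ->
  closed_proper_convex h ->
  exists B, forall u b, (h u <= b%:E)%E ->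
    B + c / 2 * enorm (u - x) ^+ 2 <= b + c * enorm (u - x) ^+ 2.
Proof.
move=> c0 /norm_minorant[x0 [a [r [r0 hr]]]].
exists (a - r * enorm (x - x0) - r ^+ 2 / (2 * c)) => u b /hr.
have : r * enorm (u - x0) <= r * (enorm (u - x) + enorm (x - x0)).
  by rewrite ler_pM2l// enorm_triangle.
set s := enorm (u - x); set D := enorm (x - x0) => H1 H2.
have := sqr_ge0 (s - r / c); rewrite -(pmulr_rge0 _ c0) => H3.
have E : c * (s - r / c) ^+ 2 = c * s ^+ 2 - 2 * (r * s) + 2 * (r ^+ 2 / (2 * c)).
  by field; rewrite gt_eqF.
by rewrite E in H3; lra.
Qed.

Lemma enorm_sqr_lower d (x v : 'cV[R]_d) e : 0 < e ->
  exists2 r, 0 < r & forall u, enorm (u - v) < r ->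
    enorm (v - x) ^+ 2 - e < enorm (u - x) ^+ 2.
Proof.
move=> e0; set D := enorm (v - x); have D0 : 0 <= D := enorm_ge0 _.
exists (e / (2 * D + 1)) => [|u uv]; first by rewrite divr_gt0//; lra.
have /= Du : D <= enorm (u - v) + enorm (u - x).
  by rewrite /D (le_trans (enorm_triangle u _ _))// enormBC.
have De : (2 * D + 1) * enorm (u - v) < e by rewrite mulrC -ltr_pdivlMr//; lra.
have := sqr_ge0 (enorm (u - x) - D).
have : D * D <= D * (enorm (u - v) + enorm (u - x)) by rewrite ler_wpM2l.
by have := enorm_ge0 (u - v); lra.
Qed.

(** The direct method: a minimizing sequence is bounded by [quadratic_minorant], and lower
    semicontinuity makes its cluster point a minimizer, which excludes the default branch of
    [xget]. *)
Lemma prox_argmin d (h : 'cV[R]_d -> \bar R) t x u : 0 < t ->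
  closed_proper_convex h -> (prox_obj t h x (prox t h x) <= prox_obj t h x u)%E.
Proof.
move=> t0 hcpc; have [hp hl hc] := hcpc.
rewrite /prox; case: xgetP => [y _ /(_ u)//|none].
have [c [c0 cE]] : exists c, 0 < c /\ (2 * t)^-1 = c.
  by exists (2 * t)^-1; rewrite invr_gt0; split=> //; lra.
have [B hB] := quadratic_minorant x c0 hcpc.
pose F q := exists u b, h u = b%:E /\ q = b + c * enorm (u - x) ^+ 2.
have hiF : has_inf [set q | F q].
  split; last first.
    exists B => _ [u' [b [hu ->]]]; have := hB u' b; rewrite hu lexx => /(_ isT).
    apply: le_trans; rewrite lerDl mulr_ge0 ?sqr_ge0//; lra.
  have [x0 hx0] := hp.1; have x0N := hp.2 x0.
  move: hx0 x0N; rewrite /edom /=; case E: (h x0) => [a| |]// _ _.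
  by exists (a + c * enorm (x0 - x) ^+ 2), x0, a.
set I := inf [set q | F q].
have /choice[w hw] k : exists w, exists b,
    h w = b%:E /\ b + c * enorm (w - x) ^+ 2 < I + k.+1%:R^-1.
  have k0 : 0 < k.+1%:R^-1 :> R by rewrite invr_gt0.
  have [_ [w [b [hw ->]]] wI] := inf_adherent k0 hiF.
  by exists w, b.
have IF q : F q -> I <= q by move=> Fq; apply: ge_inf => //; exact: hiF.2.
clearbody I.
have wM k : enorm (w k) <= 1 + 2 * (I + 1 - B) / c + enorm x.
  have [b [hb bI]] := hw k.
  have := hB (w k) b; rewrite hb lexx => /(_ isT) bB.
  have k1 : k.+1%:R^-1 <= 1 :> R by rewrite invf_le1// ler1n.
  have wx : enorm (w k - x) ^+ 2 <= 2 * (I + 1 - B) / c.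
    have {}bI : b + c * enorm (w k - x) ^+ 2 < I + 1.
      by apply: lt_le_trans bI _; rewrite lerD2l.
    by rewrite ler_pdivlMr//; lra.
  have := sqr_ge0 (enorm (w k - x) - 1).
  have := enormD (w k - x) x; rewrite subrK.
  have := sqr_ge0 (enorm (w k - x)); have := enorm_ge0 (w k - x); nra.
have [v wv] := bolzano_weierstrass wM.
exfalso; apply: (none v) => u'; rewrite /prox_obj cE.
case Eu : (h u') (hp.2 u') => [b| |]// _; last by rewrite addye ?leey.
have Iu : I <= b + c * enorm (u' - x) ^+ 2.
  by apply: IF; exists u', b.
apply: (@le_trans _ _ I%:E); last by rewrite -EFinD lee_fin.
rewrite leNgt; apply/negP => Iv.
have {Iv} : ((I - c * enorm (v - x) ^+ 2)%:E < h v)%E.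
  by rewrite EFinB lteBlDr.
move=> /ereal_between[a Ia /hl[e1 e10 he1]].
(* The margin [eta] by which the value at [v] would exceed the infimum is shared equally between the
   quadratic term and the excess [k.+1%:R^-1] of the minimizing sequence. *)
have [eta etaE] : exists eta, eta = a - (I - c * enorm (v - x) ^+ 2) by eexists.
have eta0 : 0 < eta by rewrite etaE subr_gt0.
have [|e2 e20 he2] := @enorm_sqr_lower _ x v (eta / (2 * c)).
  by rewrite divr_gt0//; lra.
have [N hN] : exists N, N.+1%:R^-1 < eta / 2.
  have eta2 : 0 < eta / 2 by lra.
  by have [N _ /(_ N (leqnn N))] := near_infty_natSinv_lt (PosNum eta2); exists N.
have [|k Nk] := wv (Num.min e1 e2) N; first by rewrite lt_min e10.
rewrite lt_min => /andP[/he1 ak /he2 vk].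
have [bk [hbk]] := hw k; rewrite hbk lte_fin in ak.
have kN : k.+1%:R^-1 <= N.+1%:R^-1 :> R by rewrite lef_pV2 ?posrE// ler_nat.
have : c * (enorm (v - x) ^+ 2 - eta / (2 * c)) < c * enorm (w k - x) ^+ 2.
  by rewrite ltr_pM2l.
have -> : c * (enorm (v - x) ^+ 2 - eta / (2 * c)) = c * enorm (v - x) ^+ 2 - eta / 2.
  by field; rewrite gt_eqF.
move=> H1 H2; suff : 0 < 0 :> R by rewrite ltxx.
by move: H2 kN hN; move: (k.+1%:R^-1) (N.+1%:R^-1) => r1 r2; lra.
Qed.

Lemma ler_forall_small (a b c : R) :
  (forall s, 0 < s -> s <= 1 -> a <= b + s * c) -> a <= b.
Proof.
move=> H; apply/ler_addgt0Pr => e e0; pose s := Num.min 1 (e / (`|c| + 1)).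
have c1 : 0 < `|c| + 1 by rewrite ltr_wpDl.
have s0 : 0 < s by rewrite lt_min ltr01 divr_gt0.
apply: le_trans (H s s0 _) _; first by rewrite ge_min lexx.
rewrite lerD2l (le_trans (ler_wpM2l (ltW s0) (ler_norm c)))//.
have : s <= e / (`|c| + 1) by rewrite ge_min lexx orbT.
by rewrite ler_pdivlMr// mulrDr; lra.
Qed.

(** The minimizer [q] is compared with [s *: u + (1 - s) *: q]: after convexity and division by [s],
    the quadratic error is of order [s] and vanishes in the limit. *)
Lemma prox_subdiff d (h : 'cV[R]_d -> \bar R) t x : 0 < t ->
  closed_proper_convex h ->
  subdiff h (prox t h x) (t^-1 *: (x - prox t h x)).
Proof.
move=> t0 hcpc u; set q := prox t h x; have [hp hl hc] := hcpc.
have qmin v : (prox_obj t h x q <= prox_obj t h x v)%E by exact: prox_argmin.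
case Eu : (h u) (hp.2 u) => [b| |]// _; last by rewrite leey.
have [a Eq] : exists a, h q = a%:E.
  have := qmin u; rewrite /prox_obj Eu; move: (hp.2 q).
  by case: (h q) => [a| |]// _ _; exists a.
rewrite Eq -EFinD lee_fin.
apply: (@ler_forall_small _ _ ((2 * t)^-1 * enorm (u - q) ^+ 2)) => s s0 s1.
have := qmin (s *: u + (1 - s) *: q); rewrite /prox_obj Eq -EFinD.
have := @convex_le _ h u q b a s hc _ _ (ltW s0) s1.
rewrite Eu Eq !lexx => /(_ isT isT).
move=> /(leeD2r ((2 * t)^-1 * enorm (s *: u + (1 - s) *: q - x) ^+ 2)%:E) H.
move=> /le_trans/(_ H).
rewrite -EFinD lee_fin.
have -> : s *: u + (1 - s) *: q - x = (q - x) + s *: (u - q).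
  by apply/colP => i; rewrite !mxE; ring.
rewrite !enorm_sqr -opprB !dot_linear.
rewrite (dotC q x) (dotC u x) (dotC u q) => {}H.
rewrite -(ler_pM2l s0).
have tE : t^-1 = 2 * (2 * t)^-1 by field; rewrite gt_eqF.
by rewrite tE; move: H; lra.
Qed.

Lemma subdiff_fin d (h : 'cV[R]_d -> \bar R) x v : proper_fun h ->
  subdiff h x v -> exists a, h x = a%:E.
Proof.
move=> [[u hu] hN] xv; move: (xv u) hu; rewrite /edom/=.
case: (h x) (hN x) => [a| |]// _; first by exists a.
by rewrite addye// leye_eq => /eqP ->.
Qed.

Lemma subdiff_monotone d (h : 'cV[R]_d -> \bar R) x u v w : proper_fun h ->
  subdiff h x v -> subdiff h u w -> 0 <= dot (v - w) (x - u).
Proof.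
move=> hp xv uw; have [a ha] := subdiff_fin hp xv; have [b hb] := subdiff_fin hp uw.
have := xv u; have := uw x; rewrite ha hb -!EFinD !lee_fin !dot_linear; lra.
Qed.

Lemma subdiff_closed d (h : 'cV[R]_d -> \bar R) x v :
  proper_fun h -> lsc_enorm h ->
  (forall e, 0 < e -> exists x' v',
     [/\ enorm (x' - x) < e, enorm (v' - v) < e & subdiff h x' v']) ->
  subdiff h x v.
Proof.
move=> hp hl xv u; case Eu : (h u) (hp.2 u) => [b| |]// _; last by rewrite leey.
rewrite leNgt; apply/negP => bx.
have {bx} : ((b - dot v (u - x))%:E < h x)%E by rewrite EFinB lteBlDr.
move=> /ereal_between[a ba /hl[e1 e10 he1]].
(* Moving [v] and [x] by less than [eta / K], and [x] by less than 1, lowers [dot v (u - x)] by at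
   most [eta]. *)
set K := enorm (u - x) + 1 + enorm v; have K0 : 0 < K.
  by have := enorm_ge0 (u - x); have := enorm_ge0 v; rewrite /K; lra.
have [eta etaE] : exists eta, eta = a - (b - dot v (u - x)) by eexists.
have eta0 : 0 < eta by rewrite etaE subr_gt0.
have [|x' [v' [x'e v'e xv']]] := xv (Num.min (Num.min e1 1) (eta / K)).
  by rewrite !lt_min e10 ltr01 divr_gt0.
move: x'e; rewrite !lt_min -andbA => /and3P[/he1 ax x'1 x'eta].
move: v'e; rewrite !lt_min -andbA => /and3P[_ _ v'eta].
have [a' ha'] := subdiff_fin hp xv'; rewrite ha' lte_fin in ax.
have := xv' u; rewrite ha' Eu -EFinD lee_fin => H1.
have H2 : dot v (u - x) - dot v' (u - x') <= enorm (v' - v) * enorm (u - x') +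
    enorm v * enorm (x' - x).
  have := abs_dot_le (v' - v) (u - x'); have := abs_dot_le v (x' - x).
  rewrite !ler_norml => /andP[_ +] /andP[+ _].
  by rewrite !dot_linear; lra.
have H3 : enorm (u - x') <= enorm (u - x) + 1.
  by rewrite (le_trans (enorm_triangle x _ _))// lerD2l enormBC ltW.
have H4 : enorm (v' - v) * enorm (u - x') <= eta / K * (enorm (u - x) + 1).
  by rewrite ler_pM ?enorm_ge0 ?(ltW v'eta).
have H5 : enorm v * enorm (x' - x) <= eta / K * enorm v.
  by rewrite mulrC ler_wpM2r ?enorm_ge0 ?(ltW x'eta).
have H6 : eta / K * (enorm (u - x) + 1) + eta / K * enorm v = eta.
  by rewrite -mulrDr -/K divfK ?gt_eqF.
suff : 0 < 0 :> R by rewrite ltxx.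
lra.
Qed.

Lemma conjugate_ge d (h : 'cV[R]_d -> \bar R) x v :
  ((dot x v)%:E - h x <= conjugate h v)%E.
Proof. by apply: ereal_sup_ubound; exists x. Qed.

Lemma conjugateNy d (h : 'cV[R]_d -> \bar R) v : proper_fun h -> conjugate h v != -oo%E.
Proof.
move=> [[x hx] hN]; have := conjugate_ge h x v; move: hx (hN x); rewrite /edom/=.
by case: (h x) => [a| |]// _ _; case: conjugate.
Qed.

(** A subgradient [v] at [x] makes [x] attain the supremum in [conjugate h v]; for any other [w] the
    same [x] is a competitor. *)
Lemma subdiff_conjugate d (h : 'cV[R]_d -> \bar R) x v : proper_fun h ->
  subdiff h x v -> subdiff (conjugate h) v x.
Proof.
move=> hp xv w; have [a ha] := subdiff_fin hp xv.
have xw := conjugate_ge h x w; apply: le_trans xw; rewrite ha.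
have : (conjugate h v <= (dot x v - a)%:E)%E.
  apply: ge_ereal_sup => _ [u _ <-]; have := xv u; rewrite ha.
  case: (h u) (hp.2 u) => [b| |]// _; last by rewrite leNye.
  by rewrite -EFinD -EFinB !lee_fin !dot_linear !(dotC _ v); lra.
move=> /(leeD2r (dot x (w - v))%:E)/le_trans; apply.
by rewrite -EFinD -EFinB lee_fin !dot_linear; lra.
Qed.

(** A proximal point supplies a subgradient, where the conjugate is finite; lower semicontinuity and
    convexity are those of a supremum of affine functions. *)
Lemma conjugate_closed_proper_convex d (h : 'cV[R]_d -> \bar R) :
  closed_proper_convex h -> closed_proper_convex (conjugate h).
Proof.
move=> hcpc; have [hp hl hc] := hcpc.
have cN v : conjugate h v != -oo%E by exact: conjugateNy.
split.
- split=> //; set q := prox 1 h 0; exists (1^-1 *: (0 - q)).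
  have qv : subdiff h q (1^-1 *: (0 - q)) by exact: prox_subdiff.
  have [a ha] := subdiff_fin hp qv.
  rewrite /edom /= (@le_lt_trans _ _ (dot q (1^-1 *: (0 - q)) - a)%:E) ?ltry//.
  apply: ge_ereal_sup => _ [u _ <-]; have := qv u; rewrite ha.
  case: (h u) (hp.2 u) => [b| |]// _; last by rewrite leNye.
  set v := _ *: _; rewrite -EFinD -EFinB !lee_fin.
  by rewrite -(opprB q u) (dotC q) (dotC u) !dot_linear; lra.
- move=> v a /ereal_sup_gt[_ [x _ <-]].
  case Ex: (h x) (hp.2 x) => [b| |]// _; rewrite -EFinB lte_fin => ab.
  have x1 : 0 < enorm x + 1 by rewrite ltr_wpDl ?enorm_ge0.
  exists ((dot x v - b - a) / (enorm x + 1)) => [|u uv].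
    by rewrite divr_gt0// subr_gt0.
  have := conjugate_ge h x u; rewrite Ex -EFinB; apply: lt_le_trans; rewrite lte_fin.
  move: uv; rewrite ltr_pdivlMr//; have := abs_dot_le x (u - v).
  rewrite ler_norml => /andP[+ _]; rewrite !dot_linear.
  by have := enorm_ge0 (u - v); lra.
- apply: convex_efun_fin => // v w a b t cv cw t0 t1.
  apply: ge_ereal_sup => _ [u _ <-].
  case Eu: (h u) (hp.2 u) => [q| |]// _; last by rewrite leNye.
  have := conjugate_ge h u v; have := conjugate_ge h u w.
  rewrite cv cw Eu -!EFinB !lee_fin !dot_linear.
  rewrite -subr_ge0 -(pmulr_rge0 _ (_ : 0 < 1 - t)) ?subr_gt0// => H1.
  by rewrite -subr_ge0 -(pmulr_rge0 _ t0) => H2; lra.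
Qed.

End ConvexFunctions.

(** * Separable sums, their conjugates and subdifferentials *)

Section SeparableSums.
Context {R : realType}.

Lemma sume_neqNy (I : finType) (P : pred I) (z : I -> \bar R) :
  (forall i, z i != -oo%E) -> (\sum_(i | P i) z i != -oo)%E.
Proof. by move=> zN; elim/big_ind: _ => // -[a| |] [b| |]. Qed.

Lemma sume_fin_or_pinfty (I : finType) (z : I -> \bar R) :
  (forall i, z i != -oo%E) ->
  (exists c : I -> R, forall i, z i = (c i)%:E) \/
  ((exists i, z i = +oo%E) /\ (\sum_i z i = +oo)%E).
Proof.
move=> zN; have [[i zi]|/forallNP z_fin] := pselect (exists i, z i = +oo%E).
  right; split; first by exists i.
  by rewrite (bigD1 i)//= zi addye// sume_neqNy.
left; exists (fun i => fine (z i)) => i.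
by case: (z i) (zN i) (z_fin i) => [a| |].
Qed.

(** Raising one entry of [a] at will excludes infinite terms; for finite terms each [a i] is taken
    within an equal share of [e]. This turns a choice of near-maximizers block by block into a bound
    on a sum of suprema. *)
Lemma sume_le_fin (I : finType) (z : I -> \bar R) (c : R) :
  (forall i, z i != -oo%E) ->
  (forall a : I -> R, (forall i, ((a i)%:E < z i)%E) -> \sum_i a i <= c) ->
  (\sum_i z i <= c%:E)%E.
Proof.
move=> zN zc; have [a0 za0] : exists a : I -> R, forall i, ((a i)%:E < z i)%E.
  suff /choice[a za] i : exists a : R, (a%:E < z i)%E by exists a.
  case: (z i) (zN i) => [r| |]// _; last by exists 0; rewrite ltry.
  by exists (r - 1); rewrite lte_fin ltrBlDr ltrDl.
have upd i b : (b%:E < z i)%E -> b + \sum_(j | j != i) a0 j <= c.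
  move=> bz; have := zc (fun j => if j == i then b else a0 j).
  rewrite (bigD1 i)//= eqxx (eq_bigr a0) => [|j /negPf ->//]; apply=> j.
  by case: eqP => // ->.
have [[r zr]|[[i zi] _]] := sume_fin_or_pinfty zN; last first.
  have := upd i (c - \sum_(j | j != i) a0 j + 1); rewrite zi ltry => /(_ isT).
  by rewrite addrAC subrK gerDl ler10.
rewrite (eq_bigr (fun i => (r i)%:E)) => [|i _]; last exact: zr.
rewrite sumEFin lee_fin; apply/ler_addgt0Pr => e e0.
have I0 : 0 < #|I|.+1%:R :> R by rewrite ltr0n.
have := zc (fun i => r i - e / #|I|.+1%:R).
rewrite big_split/= sumr_const mulNrn lerBlDr => H.
apply: le_trans (H _) _ => [i|].
  by rewrite zr lte_fin ltrBlDr ltrDl divr_gt0.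
rewrite lerD2l -[X in X <= _]mulr_natr mulrAC ler_pdivrMr// ler_pM2l// ler_nat.
exact: leqnSn.
Qed.

Context {n : nat} {m : 'I_n -> nat}.
Variable f : forall i, 'cV[R]_(m i) -> \bar R.

Lemma dot_submxcol (u v : 'cV[R]_(\sum_i m i)) :
  dot u v = \sum_i dot (submxcol u i) (submxcol v i).
Proof.
rewrite dotE -{1}(submxcolK u) -{1}(submxcolK v) tr_mxcol mul_mxrow_mxcol summxE.
by apply: eq_bigr => i _; rewrite dotE.
Qed.

Lemma submxcolZ a (u : 'cV[R]_(\sum_i m i)) i :
  submxcol (a *: u) i = a *: submxcol u i.
Proof. by apply/matrixP => j k; rewrite !mxE. Qed.

Hypothesis hf : forall i, closed_proper_convex (@f i).

Let fN i (u : 'cV[R]_(m i)) : f u != -oo%E.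
Proof. by have [[_ fN] _ _] := hf i. Qed.

Let sumf_fin (u : 'cV[R]_(\sum_i m i)) := @sume_fin_or_pinfty _
  (fun i => f (submxcol u i)) (fun i => fN (submxcol u i)).

Let cN i (v : 'cV[R]_(m i)) : conjugate (@f i) v != -oo%E.
Proof. by have [fp _ _] := hf i; exact: conjugateNy. Qed.

Lemma proper_sumf : proper_fun (sumf f).
Proof.
split; last by move=> u; apply: sume_neqNy => i; exact: fN.
have fd i : exists u : 'cV[R]_(m i), edom (@f i) u by have [[]] := hf i.
exists (\mxcol_i projT1 (cid (fd i))); rewrite /edom /sumf /=.
rewrite lt_neqAle leey andbT esum_eqy => [|i _]; last exact: fN.
apply/existsPn => i; rewrite mxcolK /=; case: cid => u /=; rewrite /edom/=.
by case: (f u).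
Qed.

Lemma convex_sumf : convex_efun (sumf f).
Proof.
apply: convex_efun_fin => [u|u v a b t ua vb t0 t1].
  by apply: sume_neqNy => i; exact: fN.
move: ua vb; rewrite /sumf.
have [[c fu]|[_ ->]//] := sumf_fin u.
have [[c' fv]|[_ ->]//] := sumf_fin v.
rewrite (eq_bigr _ (fun i _ => fu i)) (eq_bigr _ (fun i _ => fv i)) !sumEFin.
move=> [<-] [<-]; rewrite !mulr_sumr -big_split/= -sumEFin; apply: lee_sum => i _.
have [_ _ fc] := hf i; rewrite submxcolD !submxcolZ.
by apply: convex_le; rewrite ?fu ?fv// ltW.
Qed.

(** The supremum separates over the blocks: in one direction Fenchel's inequality is summed, in the
    other near-maximizers of the blocks are glued into one vector. *)
Lemma conjugate_sumf y :
  (conjugate (sumf f) y = \sum_i conjugate (@f i) (submxcol y i))%E.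
Proof.
apply/eqP; rewrite eq_le; apply/andP; split.
  apply: ge_ereal_sup => _ [u _ <-]; rewrite /sumf.
  have [[c fu]|[_ ->]] := sumf_fin u.
    rewrite (eq_bigr _ (fun i _ => fu i)) sumEFin -EFinB dot_submxcol -sumrB -sumEFin.
    by apply: lee_sum => i _; rewrite EFinB -fu; exact: conjugate_ge.
  by rewrite leNye.
case E : (conjugate (sumf f) y) (conjugateNy y proper_sumf) => [c| |]// _; last first.
  by rewrite leey.
apply: sume_le_fin => [i|a ac]; first exact: cN.
have {}ac i : exists u : 'cV[R]_(m i),
    ((a i)%:E < (dot u (submxcol y i))%:E - f u)%E.
  by have /ereal_sup_gt[_ [u _ <-] au] := ac i; exists u.
pose u := \mxcol_i projT1 (cid (ac i)).
have au i : ((a i)%:E < (dot (submxcol u i) (submxcol y i))%:E - f (submxcol u i))%E.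
  by rewrite /u mxcolK; case: cid.
have := conjugate_ge (sumf f) u y; rewrite E /sumf.
have [[q fu]|[[i fu] _]] := sumf_fin u.
  rewrite (eq_bigr _ (fun i _ => fu i)) sumEFin -EFinB dot_submxcol -sumrB lee_fin.
  apply: le_trans; apply: ler_sum => i _.
  by rewrite ltW// -lte_fin EFinB -fu.
by have := au i; rewrite fu.
Qed.

Lemma proper_conjugate_sumf : proper_fun (conjugate (sumf f)).
Proof.
have fd i : exists u : 'cV[R]_(m i), edom (conjugate (@f i)) u.
  by have [[]] := conjugate_closed_proper_convex (hf i).
split; last by move=> y; apply: conjugateNy; exact: proper_sumf.
exists (\mxcol_i projT1 (cid (fd i))); rewrite /edom /= conjugate_sumf.
rewrite lt_neqAle leey andbT esum_eqy => [|i _]; last exact: cN.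
apply/existsPn => i; rewrite mxcolK /=; case: cid => u /=; rewrite /edom/=.
by case: (conjugate _ u).
Qed.

Lemma subdiff_conjugate_sumf y w :
  subdiff (conjugate (sumf f)) y w <->
  forall i, subdiff (conjugate (@f i)) (submxcol y i) (submxcol w i).
Proof.
split=> [yw i u|yw u]; last first.
  rewrite !conjugate_sumf dot_submxcol -sumEFin -big_split/=.
  by apply: lee_sum => i _; rewrite submxcolB; exact: yw.
have [q] := subdiff_fin proper_conjugate_sumf yw; rewrite conjugate_sumf.
have [[c fy]|[_ ->]//] :=
  @sume_fin_or_pinfty _ (fun i => conjugate (@f i) (submxcol y i)) (fun i => cN _).
move=> _.
case Eu : (conjugate (@f i) u) (cN u) => [b| |]// _; last by rewrite leey.
(* Changing only block [i] makes the other terms, all finite, cancel. *)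
have := yw (\mxcol_j dfwith (submxcol y) i u j).
rewrite !conjugate_sumf (eq_bigr _ (fun i _ => fy i)) sumEFin dot_submxcol.
rewrite (bigD1 i)//= [X in ((_ + X)%:E <= _)%E](bigD1 i)//=.
rewrite [X in (_ <= X)%E](bigD1 i)//= submxcolB mxcolK dfwithin Eu.
rewrite (eq_bigr (fun j => (c j)%:E)) => [|j ji]; last first.
  by rewrite mxcolK dfwithout ?fy// eq_sym.
rewrite [X in (_ + (_ + X))%:E]big1 => [|j ji]; last first.
  by rewrite submxcolB mxcolK dfwithout 1?eq_sym// subrr dot0r.
rewrite sumEFin fy addr0 -!EFinD !lee_fin.
by move: (\sum_(j < n | _) _) => s; lra.
Qed.

End SeparableSums.

(** * Existence of a primal-dual solution by convex duality *)

Section Duality.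
Context {R : realType}.

(** [K] plays the part of the epigraph of a convex function whose domain contains a negative
    multiple of each of its points. As in the Hahn-Banach theorem, each new coordinate requires a
    slope that separates the secant slopes on its negative side from those on its positive side. *)
Lemma convex_subgradient d (K : 'cV[R]_d -> R -> Prop) (phi : R) :
  (forall w r w' r' t, K w r -> K w' r' -> 0 < t -> t < 1 ->
    K (t *: w + (1 - t) *: w') (t * r + (1 - t) * r')) ->
  (forall w r, K w r -> exists e r', 0 < e /\ K (- e *: w) r') ->
  (forall r, K 0 r -> phi <= r) ->
  exists l, forall w r, K w r -> phi + dot l w <= r.
Proof.
move=> Kcvx Kabs K0.
suff H k : (k <= d)%N -> exists l, forall w r, K w r ->
    (forall i : 'I_d, (k <= i)%N -> w i 0 = 0) -> phi + dot l w <= r.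
  have [l hl] := H d (leqnn d); exists l => w r /hl; apply=> i.
  by rewrite leqNgt ltn_ord.
elim: k => [_|k IHk kd].
  exists 0 => w r Kw w0; rewrite dot0l addr0; apply: K0.
  by rewrite (_ : 0 = w)//; apply/colP => i; rewrite w0// mxE.
have [l hl] := IHk (ltnW kd); pose i := Ordinal kd.
pose slope w r := (r - phi - dot l w) / w i 0.
pose Kk w r := K w r /\ forall j : 'I_d, (k < j)%N -> w j 0 = 0.
(* The convex combination that cancels coordinate [i] falls under the induction hypothesis, which
   compares the two slopes. *)
have Kcross w r w' r' : Kk w r -> Kk w' r' -> w i 0 < 0 -> 0 < w' i 0 ->
    slope w r <= slope w' r'.
  move=> [Kw w0] [Kw' w'0] wi w'i.
  have D : 0 < w' i 0 - w i 0 by lra.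
  pose t := w' i 0 / (w' i 0 - w i 0).
  have t0 : 0 < t by rewrite divr_gt0.
  have t1 : t < 1 by rewrite ltr_pdivrMr// mul1r; lra.
  have tE : 1 - t = - w i 0 / (w' i 0 - w i 0) by rewrite /t; field; rewrite gt_eqF.
  have := hl _ _ (Kcvx _ _ _ _ _ Kw Kw' t0 t1) _.
  have wz (j : 'I_d) : (k <= j)%N -> (t *: w + (1 - t) *: w') j 0 = 0.
    rewrite leq_eqVlt => /predU1P[ki|kj]; rewrite !mxE; last first.
      by rewrite w0// w'0// !mulr0 addr0.
    rewrite (_ : j = i) ?tE /t; last exact/val_inj.
    by field; rewrite gt_eqF.
  move=> /(_ wz); rewrite !dot_linear tE /t => H.
  have {}H : 0 <= (w' i 0 * (r - phi - dot l w)
      - w i 0 * (r' - phi - dot l w')) / (w' i 0 - w i 0).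
    move: H; rewrite -subr_ge0; congr (0 <= _).
    by field; rewrite gt_eqF.
  move: H; rewrite pmulr_lge0 ?invr_gt0// => H.
  rewrite /slope ler_pdivlMr// mulrAC ler_ndivrMr//; lra.
have Kslope a : (forall w r, Kk w r -> w i 0 < 0 -> slope w r <= a) ->
    (forall w r, Kk w r -> 0 < w i 0 -> a <= slope w r) ->
    exists l, forall w r, K w r ->
    (forall i : 'I_d, (k < i)%N -> w i 0 = 0) -> phi + dot l w <= r.
  move=> aneg apos; exists (l + a *: delta_mx i 0) => w r Kw w0.
  have -> : dot (l + a *: delta_mx i 0) w = dot l w + a * w i 0.
    rewrite dotDl dotZl /dot; congr (_ + a * _).
    rewrite (bigD1 i)//= big1 => [|j ji]; rewrite !mxE ?eqxx ?mul1r ?addr0//.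
    by rewrite (negPf ji) mul0r.
  have [wi|wi|wi] := ltrgt0P (w i 0).
  - by have := apos _ _ (conj Kw w0) wi; rewrite /slope ler_pdivlMr//; lra.
  - by have := aneg _ _ (conj Kw w0) wi; rewrite /slope ler_ndivrMr//; lra.
  - rewrite wi mulr0 addr0; apply: hl => // j.
    rewrite leq_eqVlt => /predU1P[ki|/w0//].
    by rewrite (_ : j = i)//; exact/val_inj.
have Kopp w r : Kk w r -> exists w' r', Kk w' r' /\ w' i 0 * w i 0 <= 0 /\
    (w i 0 != 0 -> w' i 0 != 0).
  move=> [/Kabs[e [r' [e0 Kw']]] w0]; exists (- e *: w), r'; split; last first.
    rewrite mxE; split; last by move=> wi; rewrite mulf_neq0// oppr_eq0 gt_eqF.
    by rewrite mulNr mulNr oppr_le0 -mulrA mulr_ge0 ?(ltW e0)// -expr2 sqr_ge0.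
  by split=> // j /w0; rewrite mxE => ->; rewrite mulr0.
(* Without points on the negative side there are none on the positive side either, by [Kopp], and
   slope 0 will do; otherwise a slope from the positive side bounds the negative ones, and their
   supremum is chosen. *)
have [[w [r [Kw wi]]]|none] := pselect (exists w r, Kk w r /\ w i 0 < 0); last first.
  apply: (Kslope 0) => w r Kw wi; first by exfalso; apply: none; exists w, r.
  have [w' [r' [Kw' [ww' w'0]]]] := Kopp _ _ Kw.
  exfalso; apply: none; exists w', r'; split=> //.
  by rewrite lt_neqAle w'0 ?gt_eqF//=; move: ww'; rewrite pmulr_lle0.
have [w' [r' [Kw' [ww' w'0]]]] := Kopp _ _ Kw.
have w'i : 0 < w' i 0.
  rewrite lt_neqAle eq_sym w'0 ?lt_eqF//=; move: ww'.
  by rewrite nmulr_lle0.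
pose S := [set q | exists w r, [/\ Kk w r, w i 0 < 0 & q = slope w r]].
have Sub : has_ubound S.
  by exists (slope w' r') => _ [w1 [r1 [Kw1 w1i ->]]]; exact: Kcross.
apply: (Kslope (sup S)) => w1 r1 Kw1 w1i.
  by apply: ub_le_sup => //; exists w1, r1.
apply: ge_sup => [|_ [w2 [r2 [Kw2 w2i ->]]]]; last exact: Kcross.
by exists (slope w r), w, r.
Qed.

Context {n d : nat} {m : 'I_n -> nat}.
Variables (f : forall i, 'cV[R]_(m i) -> \bar R) (g : 'cV[R]_d -> \bar R).
Variable A : forall i, 'M[R]_(m i, d).
Hypotheses (hf : forall i, closed_proper_convex (@f i)).
Hypothesis hg : closed_proper_convex g.

Lemma submxcol_opA (x : 'cV[R]_d) i : submxcol (opA A *m x) i = A i *m x.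
Proof. by rewrite -submxcol_mul mxcolK. Qed.

Lemma primal_objE x : primal_obj f g A x = (sumf f (opA A *m x) + g x)%E.
Proof. by congr (_ + _)%E; apply: eq_bigr => i _; rewrite submxcol_opA. Qed.

Lemma relint_absorbing k (S : set 'cV[R]_k) w : relint S 0 -> S w ->
  exists2 e, 0 < e & S (- e *: w).
Proof.
move=> [S0 [U /nbhs_enorm[e e0 eU] US]] Sw.
have w1 : 0 < enorm w + 1 by rewrite ltr_wpDl ?enorm_ge0.
have e1 : 0 < e / (enorm w + 1) by rewrite divr_gt0.
exists (e / (enorm w + 1)) => //; apply: US; split.
  apply: eU; rewrite subr0 enormZ normrN gtr0_norm// mulrAC ltr_pdivrMr//.
  by rewrite ltr_pM2l// ltrDl.
(* A multiple [- r *: w] is the affine combination of [0] and [w] with weights [1 + r] and [- r]. *)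
exists 2%N, (fun j => if j == ord0 then 1 + e / (enorm w + 1) else - (e / (enorm w + 1))).
exists (fun j => if j == ord0 then 0 else w).
rewrite !big_ord_recl !big_ord0/= !addr0 addrK scaler0 add0r; split=> // j.
by case: ifP.
Qed.

(** The dual variable is a subgradient at 0 of the perturbation function, which sends [w] to the
    infimum of [sumf f u + g v] over [u - opA A *m v = w]. *)
Lemma primal_dual_sol_exists :
  (exists u, forall v, (primal_obj f g A u <= primal_obj f g A v)%E) ->
  relint (dom_diff f g A) 0 -> primal_dual_sol f g A !=set0.
Proof.
move=> [xs xs_min] ri0; have [gp gl gc] := hg.
have [sp sc] : proper_fun (sumf f) /\ convex_efun (sumf f).
  by split; [exact: proper_sumf|exact: convex_sumf].
pose K w r := exists u v a b,
  [/\ w = u - opA A *m v, sumf f u = a%:E, g v = b%:E & a + b <= r].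
have Kdom w r : K w r -> dom_diff f g A w.
  move=> [u [v [a [b [-> ua vb _]]]]]; exists u; first by rewrite /edom/= ua ltry.
  by exists v => //; rewrite /edom/= vb ltry.
have domK w : dom_diff f g A w -> exists r, K w r.
  move=> [u su [v gv <-]]; move: su gv; rewrite /edom/=.
  case Eu : (sumf f u) (sp.2 u) => [a| |]// _ _.
  case Ev : (g v) (gp.2 v) => [b| |]// _ _.
  by exists (a + b), u, v, a, b.
(* As [0] lies in [dom_diff], some point has a finite objective, so the minimum is finite and splits
   into two real values. *)
have [phi0 [a [b [fa gb phiE]]]] : exists phi, exists a, exists b, [/\
    sumf f (opA A *m xs) = a%:E, g xs = b%:E & phi = a + b].
  have [r [u [v [a' [b' [/esym/eqP + ua vb _]]]]]] := domK _ ri0.1.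
  rewrite subr_eq0 => /eqP uE; have := xs_min v.
  rewrite !primal_objE -uE ua vb.
  case: (sumf f _) (sp.2 (opA A *m xs)) => [a| |]// _;
    case: (g xs) (gp.2 xs) => [b| |]// _ _.
  by exists (a + b), a, b.
have [|||l hl] := @convex_subgradient _ K phi0.
- move=> w r w' r' t [u [v [au [bv [-> Eu Ev abr]]]]].
  move=> [u' [v' [au' [bv' [-> Eu' Ev' abr']]]]] t0 t1.
  have := @convex_le _ _ (sumf f) u u' au au' t sc.
  rewrite Eu Eu' !lexx => /(_ isT isT (ltW t0) (ltW t1))/(proper_fin sp)[a1 Ea1 a1le].
  have := @convex_le _ _ g v v' bv bv' t gc.
  rewrite Ev Ev' !lexx => /(_ isT isT (ltW t0) (ltW t1))/(proper_fin gp)[b1 Eb1 b1le].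
  exists (t *: u + (1 - t) *: u'), (t *: v + (1 - t) *: v'), a1, b1; split=> //.
    rewrite mulmxDr -!scalemxAr; move: (_ *m v) (_ *m v') => q q'.
    by apply/colP => i; rewrite !mxE; ring.
  have : 0 <= t * (r - (au + bv)) by rewrite mulr_ge0 ?(ltW t0)// subr_ge0.
  have : 0 <= (1 - t) * (r' - (au' + bv')).
    by rewrite mulr_ge0// subr_ge0// ltW.
  lra.
- by move=> w r /Kdom /(relint_absorbing ri0)[e e0 /domK[r' Kr']]; exists e, r'.
- move=> r [u [v [a' [b' [/esym/eqP]]]]]; rewrite subr_eq0 => /eqP -> ua vb.
  have := xs_min v; rewrite !primal_objE fa gb ua vb -!EFinD lee_fin -phiE.
  exact: le_trans.
have hl' u v a' b' : sumf f u = a'%:E -> g v = b'%:E ->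
    a + b + dot l (u - opA A *m v) <= a' + b'.
  by move=> fu gv; rewrite -phiE; apply: hl; exists u, v, a', b'.
(* Freezing [u] at [opA A *m xs] gives the condition on [g]; freezing [v] at [xs] gives the one on
   [sumf f], which is then transferred to its conjugate. *)
exists (xs, l); split=> /=.
  exists (- ((opA A)^T *m l)); last by rewrite subrr.
  move=> v; case Ev : (g v) (gp.2 v) => [b'| |]// _; last by rewrite leey.
  rewrite gb -EFinD lee_fin; have := hl' _ _ _ _ fa Ev.
  rewrite -mulmxBr dotC dot_mulmxl dotNl -(opprB xs) dotNr opprK.
  by rewrite (dotC (xs - v)); lra.
exists (opA A *m xs); last by rewrite subrr.
apply: subdiff_conjugate => // u.
case Eu : (sumf f u) (sp.2 u) => [a'| |]// _; last by rewrite leey.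
by rewrite fa -EFinD lee_fin; have := hl' _ _ _ _ Eu gb; lra.
Qed.

End Duality.

(** * Chains driven by independent draws *)

Section Sampling.
Context {R : realType} {n : nat} {disp : measure_display}.
Context {Omega : measurableType disp}.
Variables (P : probability Omega R) (p : 'I_n -> R) (s : nat -> Omega -> 'I_n).
Hypothesis hs : sampling P p s.
Hypotheses (p_ge0 : forall j, 0 <= p j) (sum_p : \sum_j p j = 1).

Lemma past_le k l E : (k <= l)%N -> past s k E -> past s l E.
Proof.
move=> kl; apply: sub_sigma_algebra2 => _ [i [j [/andP[i0 ik] ->]]].
by exists i, j; split=> //; rewrite i0 (leq_trans ik).
Qed.

Lemma past_draw_event k j : (0 < k)%N -> past s k.+1 (draw_event s k j).
Proof.
by move=> k0; apply: sub_sigma_algebra; exists k, j; split; rewrite ?k0 /=.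
Qed.

Lemma past_measurable k E : past s k E -> measurable E.
Proof.
apply: smallest_sub; first exact: sigma_algebra_measurable.
by move=> _ [l [j [/andP[l0 _] ->]]]; have [] := hs j l0.
Qed.

Lemma past_setI k E F : past s k E -> past s k F -> past s k (E `&` F).
Proof. exact: (@measurableI _ (g_sigma_algebraType _)). Qed.

Lemma past_bigsetU k (F : 'I_n -> set Omega) : (forall j, past s k (F j)) ->
  past s k (\big[setU/set0]_j F j).
Proof.
move=> kF; apply: (@big_ind _ (past s k)) => //.
  exact: (@measurable0 _ (g_sigma_algebraType _)).
exact: (@measurableU _ (g_sigma_algebraType _)).
Qed.

Section Chain.
Context {S : Type}.
Variables (step : S -> 'I_n -> S) (s0 : S).

(** State [k] is built from the draws [s 1], ..., [s k], so its events lie in [past s k.+1]. *)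
Fixpoint chain k w : S :=
  if k is k'.+1 then step (chain k' w) (s k w) else s0.

Lemma setI_draw_event k (F : Omega -> 'I_n -> Prop) :
  [set w | F w (s k w)] = \big[setU/set0]_j ([set w | F w j] `&` draw_event s k j).
Proof.
rewrite -bigcup_seq; apply/seteqP; split=> [w Fw|w [j _ [/= Fw]]]; last first.
  by rewrite /draw_event /= => ->.
by exists (s k w) => //; rewrite /= mem_index_enum.
Qed.

(** The state is a function of finitely many draws with finitely many outcomes, so every predicate
    on [S] defines an event, without any measurable structure on [S]. *)
Lemma past_chain k (Q : S -> Prop) : past s k.+1 [set w | Q (chain k w)].
Proof.
elim: k Q => [|k IHk] Q /=.
  have [Qs0|Qs0] := pselect (Q s0).
    rewrite (_ : [set _ | _] = setT); last by apply/seteqP; split.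
    exact: (@measurableT _ (g_sigma_algebraType _)).
  rewrite (_ : [set _ | _] = set0); last by apply/seteqP; split.
  exact: (@measurable0 _ (g_sigma_algebraType _)).
rewrite (setI_draw_event k.+1 (fun w j => Q (step (chain k w) j))).
apply: past_bigsetU => j; apply: past_setI; last exact: past_draw_event.
exact: past_le (IHk (fun z => Q (step z j))).
Qed.

Lemma measurable_chain k (Q : S -> Prop) : measurable [set w | Q (chain k w)].
Proof. by apply: past_measurable; exact: past_chain. Qed.

(** The expectation after [k] steps as a nested finite sum: each recursive call averages out the
    last draw, that is, applies the transition operator to [W]. *)
Fixpoint mean_chain k (W : S -> R) : R :=
  if k is k'.+1 then mean_chain k' (fun z => \sum_j p j * W (step z j)) else W s0.

Lemma mean_chain_lin k a W W' :
  mean_chain k (fun z => a * W z + W' z) = a * mean_chain k W + mean_chain k W'.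
Proof.
elim: k W W' => [//|k IHk] W W' /=; rewrite -IHk; congr mean_chain; apply: funext => z.
by rewrite mulr_sumr -big_split/=; apply: eq_bigr => j _; ring.
Qed.

Lemma mean_chain_cst k c : mean_chain k (fun=> c) = c.
Proof. by elim: k => //= k IHk; rewrite -mulr_suml sum_p mul1r. Qed.

Lemma mean_chain_sum k (c : 'I_n -> R) W :
  mean_chain k (fun z => \sum_j c j * W j z) = \sum_j c j * mean_chain k (W j).
Proof.
have H (r : seq 'I_n) : mean_chain k (fun z => \sum_(j <- r) c j * W j z) =
    \sum_(j <- r) c j * mean_chain k (W j).
  elim: r => [|j r IHr].
    by rewrite big_nil; under eq_fun do rewrite big_nil; rewrite mean_chain_cst.
  rewrite big_cons -IHr -mean_chain_lin; congr mean_chain; apply: funext => z.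
  by rewrite big_cons.
exact: H.
Qed.

(** The event [D] carries the induction: splitting by the last draw intersects it with the events
    [draw_event s k.+1 j], which keeps it independent of the shorter past. *)
Lemma integral_chain k W D : measurable D ->
  (forall E, past s k.+1 E -> P (E `&` D) = (P E * P D)%E) ->
  (\int[P]_(w in D) (W (chain k w))%:E = (mean_chain k W)%:E * P D)%E.
Proof.
elim: k W D => [|k IHk] W D mD indD; first by rewrite -(integral_cst P mD).
have [r rE] : exists r, P D = r%:E.
  by exists (fine (P D)); rewrite fineK// fin_num_measure.
have DE : D = \big[setU/set0]_j (D `&` draw_event s k.+1 j).
  by rewrite -(setI_draw_event k.+1 (fun w _ => D w)).
have mDj j : measurable (D `&` draw_event s k.+1 j).
  by apply: measurableI => //; have [] := hs j (ltn0Sn k).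
rewrite [in LHS]DE integral_bigsetU_EFin//; last 3 first.
- exact: index_enum_uniq.
- apply/trivIsetP => i j _ _ /eqP ij; apply/seteqP; split=> // w [[_ +] [_]].
  by rewrite /draw_event /= => -> /ij.
- move=> mU B mB; apply: measurableI => //.
  exact: (measurable_chain k.+1 (fun z => B (W z)%:E)).
rewrite /= mean_chain_sum rE -EFinM mulr_suml -sumEFin; apply: eq_bigr => j _.
have [mj Pj indj] := hs j (ltn0Sn k).
transitivity (\int[P]_(w in D `&` draw_event s k.+1 j)
    (W (step (chain k w) j))%:E)%E.
  by apply: eq_integral => w; rewrite inE => -[_]; rewrite /draw_event /= => ->.
have PDj : P (D `&` draw_event s k.+1 j) = (r * p j)%:E.
  by rewrite setIC indD ?Pj ?rE -?EFinM 1?mulrC//; exact: past_draw_event.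
rewrite (IHk (fun z => W (step z j)))// => [|E kE].
  by rewrite PDj -EFinM; congr EFin; ring.
have [q qE] : exists q, P E = q%:E.
  exists (fine (P E)); rewrite fineK// fin_num_measure//.
  by apply: past_measurable; exact: kE.
rewrite (setIC D) setIA indD; last first.
  by apply: past_setI; [exact: past_le kE|exact: past_draw_event].
by rewrite indj// setIC PDj Pj rE qE -!EFinM; congr EFin; ring.
Qed.

Lemma expectation_chain k W : ('E_P[fun w => W (chain k w)] = (mean_chain k W)%:E)%E.
Proof.
rewrite unlock integral_chain//; first by rewrite probability_setT mule1.
by move=> E _; rewrite setIT probability_setT mule1.
Qed.

Lemma probability_chain k (Q : S -> Prop) :
  P [set w | Q (chain k w)] = (mean_chain k (fun z => (`[< Q z >])%:R))%:E.
Proof.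
rewrite -expectation_chain unlock.
have mQ := measurable_chain k Q.
rewrite -[LHS]mul1e -integral_cst//.
rewrite integral_mkcond; apply: eq_integral => w _; rewrite patchE /=.
by case: asboolP => [Qw|Qw]; [rewrite mem_set|rewrite memNset].
Qed.

Variable Inv : S -> Prop.
Hypotheses (Inv0 : Inv s0) (InvS : forall z j, Inv z -> Inv (step z j)).

Lemma Inv_chain k w : Inv (chain k w).
Proof. by elim: k => //= k; exact: InvS. Qed.

Lemma mean_chain_le k W W' : (forall z, Inv z -> W z <= W' z) ->
  mean_chain k W <= mean_chain k W'.
Proof.
elim: k W W' => [|k IHk] W W' WW' /=; first exact: WW'.
apply: IHk => z Iz; apply: ler_sum => j _.
by apply: ler_wpM2l => //; exact/WW'/InvS.
Qed.

Lemma supermartingale_mean_chain U k :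
  (forall z, Inv z -> \sum_j p j * U (step z j) <= U z) -> mean_chain k U <= U s0.
Proof.
by move=> US; elim: k => //= k; apply: le_trans; exact: mean_chain_le.
Qed.

(** Telescoping of the drift inequality; both bounds on expectations are read off from it. *)
Lemma supermartingale_decrement_mean_chain U D k :
  (forall z, Inv z -> \sum_j p j * U (step z j) <= U z - D z) ->
  mean_chain k U + \sum_(i < k) mean_chain i D <= U s0.
Proof.
move=> US; elim: k => [|k]; first by rewrite big_ord0 addr0.
apply: le_trans; rewrite big_ord_recr/= [X in _ + X]addrC addrA lerD2r.
have -> : mean_chain k U = mean_chain k (fun z => U z - D z) + mean_chain k D.
  rewrite -[X in X + _]mul1r -mean_chain_lin; congr mean_chain; apply: funext => z.
  by rewrite mul1r subrK.
by rewrite lerD2r; exact: mean_chain_le.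
Qed.

End Chain.

(* Ville's maximal inequality.  The Boolean component freezes the value at
   [lam] once the level has been reached. *)
Lemma ville (S : Type) (step : S -> 'I_n -> S) (s0 : S) (Inv : S -> Prop)
    (U : S -> R) (lam : R) :
  Inv s0 -> (forall z j, Inv z -> Inv (step z j)) -> 0 < lam ->
  (forall z, Inv z -> 0 <= U z) ->
  (forall z, Inv z -> \sum_j p j * U (step z j) <= U z) ->
  let F := [set w | exists k, lam <= U (chain step s0 k w)] in
  measurable F /\ (P F <= (U s0 / lam)%:E)%E.
Proof.
move=> Is0 Istep lam0 U0 Usuper F.
pose step' (z : S * bool) j := let z' := step z.1 j in (z', z.2 || (lam <= U z')).
pose s0' := (s0, lam <= U s0); pose chain' := chain step' s0'.
have chain'1 k w : (chain' k w).1 = chain step s0 k w.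
  by elim: k => //= k <-.
pose G k := [set w | (chain' k w).2].
have FE : F = \bigcup_k G k.
  apply/seteqP; split=> w [k].
    move=> Uk; exists k => //; rewrite /G /=; case: k Uk => //= k Uk.
    by rewrite chain'1 Uk orbT.
  move=> _; rewrite /G /=; elim: k => [|k IHk] /=; first by exists 0%N.
  by case/orP => [//|]; rewrite chain'1 => Uk; exists k.+1.
have mG k : measurable (G k).
  exact: (measurable_chain step' s0' k (fun z : S * bool => is_true z.2)).
have mF : measurable F by rewrite FE; exact: bigcupT_measurable.
split=> //; rewrite FE.
have ndG : nondecreasing_seq G.
  apply/nondecreasing_seqP => k; apply/subsetPset => w.
  by rewrite /G /= => ->.
have cvgG := @nondecreasing_cvg_mu _ _ _ P G mG (bigcupT_measurable _ mG) ndG.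
rewrite -(cvg_lim _ cvgG)//; apply: lime_le; first by apply/cvg_ex; eexists; exact: cvgG.
apply: nearW => k /=.
rewrite (probability_chain step' s0' k (fun z : S * bool => is_true z.2)) lee_fin mulrC.
pose U' (z : S * bool) := if z.2 then lam else U z.1.
have I0' : Inv s0'.1 by [].
have IS' (z : S * bool) j : Inv z.1 -> Inv (step' z j).1 by exact: Istep.
(* Markov's inequality: the indicator of the flag is at most [U' z / lam]. The summand [0] matches
   the form of [mean_chain_lin]. *)
apply: (@le_trans _ _ (mean_chain step' s0' k (fun z => lam^-1 * U' z + 0))).
  apply: (@mean_chain_le _ _ _ (fun z => Inv z.1)) => // -[z b]; rewrite /U' /= addr0 => Iz.
  case: asboolP => [->|_]; first by rewrite mulVf ?gt_eqF.
  by case: b; rewrite mulr_ge0 ?invr_ge0 ?(ltW lam0) ?U0.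
rewrite mean_chain_lin mean_chain_cst addr0 ler_pM2l ?invr_gt0//.
apply: (@le_trans _ _ (U' s0')); last by rewrite /U' /s0' /=; case: ifP.
apply: (@supermartingale_mean_chain _ _ _ (fun z => Inv z.1)) => // -[z b] /= Iz.
case: b => /=; rewrite /U' /=; first by rewrite -mulr_suml sum_p mul1r.
apply: le_trans (Usuper z Iz); apply: ler_sum => j _; apply: ler_wpM2l => //.
by case: ifP.
Qed.

(** The intersection of covering events of probability at most [i.+1%:R^-1] is null. *)
Lemma negligible_small (N : set Omega) :
  (forall e, 0 < e -> exists F, [/\ measurable F, N `<=` F & (P F <= e%:E)%E]) ->
  P.-negligible N.
Proof.
move=> small.
have /choice[F hF] i : exists F, [/\ measurable F, N `<=` F & (P F <= (i.+1%:R^-1)%:E)%E].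
  by apply: small; rewrite invr_gt0.
have mF : measurable (\bigcap_i F i).
  by apply: bigcapT_measurable => i; have [] := hF i.
exists (\bigcap_i F i); split=> //; last first.
  by move=> w Nw i _; have [_ + _] := hF i; apply.
apply/eqP; rewrite eq_le measure_ge0 andbT; apply/lee_addgt0Pr => e e0.
rewrite add0e; have [N0 _ /(_ N0 (leqnn N0))/ltW/= N0e] := near_infty_natSinv_lt (PosNum e0).
have [mFN _ PFN] := hF N0.
apply: (@le_trans _ _ (P (F N0))); first by rewrite le_measure ?inE//; exact: bigcap_inf.
by rewrite (le_trans PFN)// lee_fin.
Qed.

(** * Almost sure behaviour of nonnegative supermartingales *)

Section AlmostSure.
Context {S C : Type}.
Variables (step : S -> 'I_n -> S) (s0 : S) (Inv : S -> Prop).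
Hypotheses (Inv0 : Inv s0) (InvS : forall z j, Inv z -> Inv (step z j)).
Variables (M : C -> S -> R) (D : S -> R).
Hypothesis M_ge0 : forall c z, Inv z -> 0 <= M c z.
Hypothesis D_ge0 : forall z, Inv z -> 0 <= D z.
Hypothesis M_super : forall c z, Inv z ->
  \sum_j p j * M c (step z j) <= M c z - D z.

(** Adding the running sum of the decrements to [M c] again gives a nonnegative supermartingale, on
    the state enlarged by that sum; Ville's inequality at high levels bounds it. *)
Lemma ae_bounded_supermartingale (c : C) :
  {ae P, forall w, exists B, forall k,
    M c (chain step s0 k w) + \sum_(i < k) D (chain step s0 i w) <= B}.
Proof.
pose step' (z : S * R) j := (step z.1 j, z.2 + D z.1).
pose U (z : S * R) := M c z.1 + z.2.
have chain'E k w : chain step' (s0, 0) k w =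
    (chain step s0 k w, \sum_(i < k) D (chain step s0 i w)).
  by elim: k => [|k IHk] /=; rewrite ?big_ord0// IHk big_ord_recr.
have U0 : 0 <= U (s0, 0) by rewrite /U addr0 M_ge0.
apply: negligible_small => e e0.
(* The [+ 1] keeps the level positive when the process starts at 0; the exceptional event still has
   probability at most [e]. *)
have lam0 : 0 < (U (s0, 0) + 1) / e by rewrite divr_gt0// ltr_wpDl.
have [||||mF PF] := @ville _ step' (s0, 0) (fun z => Inv z.1 /\ 0 <= z.2) U _ _ _ lam0.
- by [].
- by move=> z j [Iz z0]; split; [exact: InvS|rewrite addr_ge0// D_ge0].
- by move=> z [Iz z0]; rewrite addr_ge0// M_ge0.
- move=> z [Iz z0]; rewrite /U /step' /=.
  under eq_bigr do rewrite mulrDr.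
  rewrite big_split/= -mulr_suml sum_p mul1r; have := M_super c Iz; lra.
exists [set w | exists k, (U (s0, 0) + 1) / e <= U (chain step' (s0, 0) k w)].
split=> //.
  move=> w /= nB; apply: contrapT => /forallNP nF; apply: nB.
  exists ((U (s0, 0) + 1) / e) => k; have := nF k.
  by rewrite chain'E /U /= => /negP; rewrite -ltNge => /ltW.
apply: le_trans PF _; rewrite lee_fin invf_div mulrA ler_pdivrMr; last by rewrite ltr_wpDl.
by rewrite mulrC ler_pM2l// lerDl.
Qed.

(* The center [c] is frozen at the first time when some [M c] is at most
   [delta]; from then on [M c] stays below [lam] except on an event of
   probability [delta / lam]. *)
Lemma ae_recurrent_supermartingale (lam : R) : 0 < lam ->
  {ae P, forall w,
    (forall delta, 0 < delta -> exists k c, M c (chain step s0 k w) <= delta) ->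
    exists c K, forall k, (K <= k)%N -> M c (chain step s0 k w) < lam}.
Proof.
move=> lam0; apply: negligible_small => e e0; pose delta := e * lam.
have delta0 : 0 < delta by rewrite mulr_gt0.
pose start z := if pselect (exists c, M c z <= delta) is left h
  then Some (projT1 (cid h)) else None.
pose step' (z : S * option C) j := let z' := step z.1 j in
  (z', if z.2 is Some c then Some c else start z').
(* Before a center is chosen the process is the constant [delta]; choosing one cannot raise it, by
   [Ustart], so the supermartingale property survives the switch. *)
pose U (z : S * option C) := if z.2 is Some c then M c z.1 else delta.
have Ustart z : U (z, start z) <= delta.
  by rewrite /U /start; case: pselect => //= h; case: cid.
pose ch := chain step' (s0, start s0).
have ch1 k w : (ch k w).1 = chain step s0 k w by elim: k => //= k <-.
have [||||mF PF] := @ville _ step' (s0, start s0) (fun z => Inv z.1) U _ _ _ lam0.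
- by [].
- by move=> z j; exact: InvS.
- by move=> [z [c|]] Iz; rewrite /U /= ?M_ge0 ?(ltW delta0).
- move=> [z [c|]] Iz; rewrite /U /=.
    by apply: le_trans (M_super c Iz) _; rewrite gerBl D_ge0.
  rewrite -[leRHS]mul1r -sum_p mulr_suml; apply: ler_sum => j _.
  by apply: ler_wpM2l => //; exact: Ustart.
exists [set w | exists k, lam <= U (ch k w)]; split=> //; last first.
  apply: le_trans PF _; rewrite lee_fin ler_pdivrMr//; exact: Ustart.
move=> w /= nrec; apply: contrapT => /forallNP nF; apply: nrec.
move=> /(_ delta delta0)[K [c McK]].
(* By time [K] a center is frozen, since otherwise [start] would have succeeded there because of
   [c]; it may differ from [c]. *)
have [c' chK] : exists c', (ch K w).2 = Some c'.
  case E : (ch K w).2 => [c'|]; first by exists c'.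
  have startK : (ch K w).2 = start (ch K w).1.
    by case: K E {McK} => // K; rewrite /ch /=; case: (chain _ _ K w).2.
  move: startK; rewrite E /start ch1; case: pselect => // nc _.
  by exfalso; apply: nc; exists c.
exists c', K => k Kk.
have {}chK : (ch k w).2 = Some c'.
  elim: k Kk => [|k IHk]; first by rewrite leqn0 => /eqP <-.
  by rewrite leq_eqVlt => /predU1P[<-//|/IHk]; rewrite /ch /= => ->.
have := nF k; rewrite /U chK ch1 => /negP.
by rewrite -ltNge.
Qed.

End AlmostSure.

End Sampling.

(** * The SPDHG iteration *)

Section SmallTerms.
Context {R : realType}.

Lemma bounded_series_small (a : nat -> R) B : (forall k, 0 <= a k) ->
  (forall k, \sum_(i < k) a i <= B) ->
  forall e, 0 < e -> exists N, forall k, (N <= k)%N -> a k < e.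
Proof.
move=> a0 aB e e0.
have scvg : cvgn (series a).
  apply: nondecreasing_is_cvgn.
    by apply/nondecreasing_seqP => k; rewrite /series /= big_nat_recr//= lerDl.
  by exists B => _ [k _ <-]; rewrite /series /= big_mkord.
have /cvgr0Pnorm_lt/(_ e e0)[N _ hN] := cvg_series_cvg_0 scvg.
by exists N => k /hN /=; exact: le_lt_trans (ler_norm _).
Qed.

Lemma enorm_col_mx_sqr k l (u : 'cV[R]_k) (v : 'cV[R]_l) :
  enorm (col_mx u v) ^+ 2 = enorm u ^+ 2 + enorm v ^+ 2.
Proof. by rewrite !enorm_sqr !dotE tr_col_mx mul_row_col mxE. Qed.

Lemma enorm_col_mx_le k l (u : 'cV[R]_k) (v : 'cV[R]_l) :
  enorm (col_mx u v) <= enorm u + enorm v.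
Proof.
rewrite -(@ler_pXn2r _ 2)// ?nnegrE ?addr_ge0 ?enorm_ge0// enorm_col_mx_sqr sqrrD.
by have := mulr_ge0 (enorm_ge0 u) (enorm_ge0 v); lra.
Qed.

Lemma enorm_le_col_mxu k l (u : 'cV[R]_k) (v : 'cV[R]_l) :
  enorm u <= enorm (col_mx u v).
Proof.
rewrite -(@ler_pXn2r _ 2)// ?nnegrE ?enorm_ge0// enorm_col_mx_sqr.
by rewrite lerDl sqr_ge0.
Qed.

Lemma enorm_le_col_mxd k l (u : 'cV[R]_k) (v : 'cV[R]_l) :
  enorm v <= enorm (col_mx u v).
Proof.
rewrite -(@ler_pXn2r _ 2)// ?nnegrE ?enorm_ge0// enorm_col_mx_sqr.
by rewrite lerDr sqr_ge0.
Qed.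

End SmallTerms.

(** * Lyapunov analysis of the iteration and convergence along one realization *)

Section Lyapunov.
Context {R : realType} {n d : nat} {m : 'I_n -> nat}.
Local Notation X := 'cV[R]_d.
Local Notation Y := 'cV[R]_(\sum_i m i).
Variables (f : forall i, 'cV[R]_(m i) -> \bar R) (g : X -> \bar R).
Variable A : forall i, 'M[R]_(m i, d).
Variables (p sigma : 'I_n -> R) (tau gamma : R).
Hypotheses (hf : forall i, closed_proper_convex (@f i)).
Hypothesis hg : closed_proper_convex g.
Hypotheses (hp : forall i, 0 < p i) (hp1 : \sum_i p i = 1).
Hypotheses (htau : 0 < tau) (hsigma : forall i, 0 < sigma i).
Hypotheses (hgamma0 : 0 <= gamma) (hgamma1 : gamma < 1).
Hypothesis hstep : forall i,
  (p i)^-1 * tau * sigma i * opnorm (A i) ^+ 2 <= gamma ^+ 2.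

Lemma dot_opA_invP (u : X) (y : Y) :
  dot (opA A *m u) (invP p y) = \sum_i (p i)^-1 * dot (A i *m u) (submxcol y i).
Proof.
rewrite dot_submxcol; apply: eq_bigr => i _.
by rewrite submxcol_opA mxcolK dotZr.
Qed.

Lemma wsp_gt0 i : 0 < wsp p sigma i.
Proof. by rewrite mulr_gt0 ?invr_gt0. Qed.

Lemma wnorm2_ge0 w (y : Y) : (forall i, 0 < w i) -> 0 <= wnorm2 w y.
Proof. by move=> w0; apply: sumr_ge0 => i _; rewrite mulr_ge0 ?sqr_ge0// ltW. Qed.

Lemma enorm_sqr_submxcol (y : Y) : enorm y ^+ 2 = \sum_i enorm (submxcol y i) ^+ 2.
Proof.
by rewrite enorm_sqr dot_submxcol; apply: eq_bigr => i _; rewrite enorm_sqr.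
Qed.

Lemma wnorm2_le w (y : Y) : (forall i, 0 < w i) ->
  wnorm2 w y <= (\sum_i w i) * enorm y ^+ 2.
Proof.
move=> w0; rewrite mulr_suml; apply: ler_sum => i _; apply: ler_wpM2l.
  exact: ltW.
rewrite enorm_sqr_submxcol (bigD1 i)//= lerDl.
by apply: sumr_ge0 => j _; exact: sqr_ge0.
Qed.

Lemma le_wnorm2 w (y : Y) : (forall i, 0 < w i) ->
  enorm y ^+ 2 <= (\sum_i (w i)^-1) * wnorm2 w y.
Proof.
move=> w0; rewrite enorm_sqr_submxcol mulr_suml; apply: ler_sum => i _.
rewrite ler_pdivlMl// /wnorm2 (bigD1 i)//= lerDl.
by apply: sumr_ge0 => j _; rewrite mulr_ge0 ?sqr_ge0// ltW.
Qed.

(** Let [a] and [b] be the two summands on the right. By Cauchy-Schwarz and the step size condition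
    the square of the left-hand side is at most [gamma ^+ 2 * (a * b)], and [a * b] is at most
    [((a + b) / 2) ^+ 2]. *)
Lemma block_cross_le i (u : X) (v : 'cV[R]_(m i)) :
  `|(p i)^-1 * dot (A i *m u) v| <=
  gamma / 2 * (tau^-1 * enorm u ^+ 2 + wsp p sigma i * enorm v ^+ 2).
Proof.
set a := tau^-1 * _; set b := wsp _ _ _ * _.
have a0 : 0 <= a by rewrite mulr_ge0 ?sqr_ge0// invr_ge0 ltW.
have b0 : 0 <= b by rewrite mulr_ge0 ?sqr_ge0// ltW// wsp_gt0.
have pi0 : 0 < (p i)^-1 by rewrite invr_gt0.
rewrite normrM gtr0_norm//.
apply: (@le_trans _ _ ((p i)^-1 * (opnorm (A i) * enorm u * enorm v))).
  rewrite ler_pM2l// (le_trans (abs_dot_le _ _))// ler_wpM2r ?enorm_ge0//.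
  exact: le_opnorm.
rewrite -(@ler_pXn2r _ 2)// ?nnegrE ?mulr_ge0 ?enorm_ge0 ?opnorm_ge0 ?addr_ge0 ?(ltW pi0)//.
apply: (@le_trans _ _ (gamma ^+ 2 * (a * b))).
  have -> : ((p i)^-1 * (opnorm (A i) * enorm u * enorm v)) ^+ 2 =
      (p i)^-1 * tau * sigma i * opnorm (A i) ^+ 2 * (a * b).
    by rewrite /a /b /wsp; field; rewrite !gt_eqF.
  by rewrite ler_wpM2r// mulr_ge0.
rewrite exprMn exprMn -mulrA ler_wpM2l ?sqr_ge0//.
by have := sqr_ge0 (a - b); lra.
Qed.

Definition single_block (y : Y) := exists j, forall i, i != j -> submxcol y i = 0.

(** With one nonzero block the term in [u] is charged once, instead of once per block. *)
Lemma cross_le (u : X) (y : Y) : single_block y ->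
  `|dot (opA A *m u) (invP p y)| <=
  gamma / 2 * (tau^-1 * enorm u ^+ 2 + wnorm2 (wsp p sigma) y).
Proof.
move=> [j yj]; rewrite dot_opA_invP (bigD1 j)//= big1 => [|i ij]; last first.
  by rewrite yj// dot0r mulr0.
rewrite addr0 (le_trans (block_cross_le _ _))//.
apply: ler_wpM2l; first by rewrite divr_ge0.
rewrite lerD2l /wnorm2 (bigD1 j)//= lerDl.
by apply: sumr_ge0 => i _; rewrite mulr_ge0 ?sqr_ge0// ltW// wsp_gt0.
Qed.

(* A state is the triple (x^(k-1), y^(k-1), y^k). *)
Local Notation state := (X * Y * Y)%type.
Implicit Type z : state.

Definition xnext z : X :=
  prox tau g (z.1.1 - tau *: ((opA A)^T *m (z.2 + invP p (z.2 - z.1.2)))).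

(** The update of all dual blocks at once. It does not depend on the draw, which only selects the
    block to be copied from it. *)
Definition yhat z : Y := \mxcol_i prox (sigma i) (conjugate (@f i))
  (submxcol z.2 i + sigma i *: (A i *m xnext z)).

Definition spdhg_step z (j : 'I_n) : state :=
  (xnext z, z.2, \mxcol_i (if i == j then submxcol (yhat z) i else submxcol z.2 i)).

Definition lyap (c : X * Y) z : R :=
  Vk A p sigma tau z.2 z.1.2 (z.1.1 - c.1) (z.2 - c.2).

(** This is [V (z^k - z^(k-1))]: [xnext z] is [x^k], while [y^k] already belongs to the state. *)
Definition decr z : R := V A p sigma tau (xnext z - z.1.1) (z.2 - z.1.2).

Definition spdhg_inv z := single_block (z.2 - z.1.2).

Lemma spdhg_step_inv z j : spdhg_inv (spdhg_step z j).
Proof. by exists j => i ij; rewrite submxcolB mxcolK (negPf ij) subrr. Qed.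

Lemma xnext_subdiff z : subdiff g (xnext z)
  (tau^-1 *: (z.1.1 - xnext z) - (opA A)^T *m (z.2 + invP p (z.2 - z.1.2))).
Proof.
have := prox_subdiff (z.1.1 - tau *: ((opA A)^T *m (z.2 + invP p (z.2 - z.1.2)))) htau hg.
rewrite -/(xnext z); congr (subdiff g _ _).
by rewrite !scalerBr scalerA mulVf ?gt_eqF// scale1r addrAC.
Qed.

Lemma yhat_subdiff z i : subdiff (conjugate (@f i)) (submxcol (yhat z) i)
  ((sigma i)^-1 *: (submxcol z.2 i - submxcol (yhat z) i) + A i *m xnext z).
Proof.
rewrite mxcolK; have := prox_subdiff (submxcol z.2 i + sigma i *: (A i *m xnext z))
  (hsigma i) (conjugate_closed_proper_convex (hf i)).
set q := prox _ _ _; congr (subdiff _ _ _).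
by rewrite addrAC scalerDr scalerA mulVf ?gt_eqF// scale1r.
Qed.

Definition wyhat z : R := wnorm2 (fun i => (sigma i)^-1) (yhat z - z.2).

Lemma wnorm2_step z j :
  wnorm2 (wsp p sigma) ((spdhg_step z j).2 - z.2) =
  wsp p sigma j * enorm (submxcol (yhat z - z.2) j) ^+ 2.
Proof.
rewrite /wnorm2 (bigD1 j)//= [X in _ + X]big1 ?addr0 => [|i ij]; last first.
  by rewrite submxcolB mxcolK (negPf ij) subrr enorm0 expr0n mulr0.
by rewrite !submxcolB mxcolK eqxx.
Qed.

Lemma wspE i : p i * wsp p sigma i = (sigma i)^-1.
Proof. by rewrite /wsp mulrCA divff ?mulr1// gt_eqF. Qed.

(** One block moves at a time, and the factor [(p j)^-1] in its weight cancels the probability of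
    drawing it. *)
Lemma mean_wnorm2_step z :
  \sum_j p j * wnorm2 (wsp p sigma) ((spdhg_step z j).2 - z.2) = wyhat z.
Proof.
by apply: eq_bigr => j _; rewrite wnorm2_step mulrA wspE.
Qed.

Lemma lyap_step c z j : lyap c (spdhg_step z j) =
  2^-1 * (tau^-1 * enorm (xnext z - c.1) ^+ 2)
  - (p j)^-1 * dot (A j *m (xnext z - c.1)) (submxcol (yhat z - z.2) j)
  + 2^-1 * (wsp p sigma j * enorm (submxcol (yhat z - z.2) j) ^+ 2)
  + 2^-1 * (wnorm2 (wsp p sigma) (z.2 - c.2) + wsp p sigma j *
      (enorm (submxcol (yhat z - c.2) j) ^+ 2 - enorm (submxcol (z.2 - c.2) j) ^+ 2)).
Proof.
rewrite /lyap /Vk wnorm2_step dot_opA_invP; congr (_ - _ + _ + _ * _).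
  rewrite (bigD1 j)//= [X in _ + X]big1 ?addr0 => [|i ij]; last first.
    by rewrite submxcolB mxcolK (negPf ij) subrr dot0r mulr0.
  by rewrite !submxcolB mxcolK eqxx.
rewrite /wnorm2 (bigD1 j)//= [in RHS](bigD1 j)//=.
rewrite [in LHS](eq_bigr (fun i => wsp p sigma i * enorm (submxcol (z.2 - c.2) i) ^+ 2)).
  by rewrite !submxcolB mxcolK eqxx; ring.
by move=> i ij; rewrite !submxcolB mxcolK (negPf ij).
Qed.

(** The subdifferential of [g] is monotone between [xnext z] and [c.1], that of each conjugate
    between the blocks of [yhat z] and [c.2]. Expanding squares turns these inner products into
    differences of squared norms, and averaging over the draw removes the factors [(p j)^-1]. *)
Lemma lyap_decrease c z : primal_dual_sol f g A c ->
  \sum_j p j * lyap c (spdhg_step z j) <= lyap c z - decr z.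
Proof.
case: c => c1 c2 [[v /= gv /eqP]]; rewrite addrC addr_eq0 => /eqP vE.
move=> [w /= fw /eqP]; rewrite subr_eq0 => /eqP wE.
move: gv fw; rewrite {}vE -{}wE => gv /(subdiff_conjugate_sumf hf) fw.
have hgp := let: And3 h _ _ := hg in h.
set xp := xnext z; set dy := z.2 - z.1.2.
have primal := subdiff_monotone hgp (xnext_subdiff z) gv.
have dual i : 0 <= dot ((sigma i)^-1 *: (submxcol z.2 i - submxcol (yhat z) i)
    + A i *m (xp - c1)) (submxcol (yhat z) i - submxcol c2 i).
  have hfp := let: And3 h _ _ := conjugate_closed_proper_convex (hf i) in h.
  have := subdiff_monotone hfp (@yhat_subdiff z i) (fw i).
  by rewrite submxcol_opA mulmxBr addrA.
have Esum : \sum_j p j * lyap (c1, c2) (spdhg_step z j) =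
    2^-1 * (tau^-1 * enorm (xp - c1) ^+ 2) + 2^-1 * wnorm2 (wsp p sigma) (z.2 - c2)
    + \sum_j (- dot (A j *m (xp - c1)) (submxcol (yhat z - z.2) j)
      + 2^-1 * ((sigma j)^-1 * (enorm (submxcol (yhat z - z.2) j) ^+ 2 +
        enorm (submxcol (yhat z - c2) j) ^+ 2 - enorm (submxcol (z.2 - c2) j) ^+ 2))).
  set r := 2^-1 * _ + _; have -> : r = \sum_j p j * r by rewrite -mulr_suml hp1 mul1r.
  rewrite -big_split/=; apply: eq_bigr => j _; rewrite {}/r.
  by rewrite lyap_step -wspE /=; field; rewrite !gt_eqF.
(* Dual monotonicity, block by block; the coupling left on the right cancels against the one in the
   primal inequality. *)
have Ele : \sum_j (- dot (A j *m (xp - c1)) (submxcol (yhat z - z.2) j)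
      + 2^-1 * ((sigma j)^-1 * (enorm (submxcol (yhat z - z.2) j) ^+ 2 +
        enorm (submxcol (yhat z - c2) j) ^+ 2 - enorm (submxcol (z.2 - c2) j) ^+ 2)))
    <= dot (opA A *m (xp - c1)) (z.2 - c2).
  rewrite dot_submxcol; apply: ler_sum => j _; rewrite submxcol_opA !submxcolB.
  have := dual j; rewrite !enorm_sqr !dot_linear.
  move: (submxcol (yhat z) j) (submxcol z.2 j) (submxcol c2 j) (A j *m _) => q y c a.
  rewrite (dotC y q) (dotC c q) (dotC c y); lra.
rewrite Esum; move: primal Ele; rewrite /lyap /decr /Vk /V -/xp -/dy /=.
have -> : dot (tau^-1 *: (z.1.1 - xp) - (opA A)^T *m (z.2 + invP p dy) - - ((opA A)^T *m c2))
    (xp - c1) = tau^-1 * dot (z.1.1 - xp) (xp - c1)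
    - dot (opA A *m (xp - c1)) (z.2 - c2) - dot (opA A *m (xp - c1)) (invP p dy).
  rewrite opprK [in RHS](dot_mulmxl _ _ (z.2 - c2)) dot_mulmxl mulmxDr mulmxBr.
  rewrite !(dotC (xp - c1)) !dot_linear; ring.
rewrite [opA A *m (xp - c1)]mulmxBr [opA A *m (z.1.1 - c1)]mulmxBr.
rewrite [opA A *m (xp - z.1.1)]mulmxBr.
rewrite !enorm_sqr !dot_linear.
move: (\sum_(i < n) (- _ + _ * _)) (wnorm2 _ (z.2 - c2)) (wnorm2 _ dy) => S1 w1 w2.
rewrite (dotC c1 xp) (dotC z.1.1 xp) (dotC c1 z.1.1); lra.
Qed.

Lemma half_slack_gt0 : 0 < (1 - gamma) / 2.
Proof. by rewrite divr_gt0// subr_gt0. Qed.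

Lemma tau_enorm_ge0 k (u : 'cV[R]_k) : 0 <= tau^-1 * enorm u ^+ 2.
Proof. by rewrite mulr_ge0 ?sqr_ge0// invr_ge0 ltW. Qed.

Lemma wnorm2_wsp_ge0 (y : Y) : 0 <= wnorm2 (wsp p sigma) y.
Proof. exact: wnorm2_ge0 wsp_gt0. Qed.

(** By [cross_le] the coupling term consumes at most a fraction [gamma] of the two squares. *)
Lemma lyap_ge c z : spdhg_inv z ->
  (1 - gamma) / 2 * (tau^-1 * enorm (z.1.1 - c.1) ^+ 2
    + wnorm2 (wsp p sigma) (z.2 - z.1.2))
  + 2^-1 * wnorm2 (wsp p sigma) (z.2 - c.2) <= lyap c z.
Proof.
move=> /(cross_le (z.1.1 - c.1)); rewrite /lyap /Vk ler_norml => /andP[_].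
by move: (dot _ _) (tau^-1 * _) (wnorm2 _ _) (wnorm2 _ _) => a b w1 w2; lra.
Qed.

Lemma lyap_le c z : spdhg_inv z ->
  lyap c z <= tau^-1 * enorm (z.1.1 - c.1) ^+ 2
    + wnorm2 (wsp p sigma) (z.2 - z.1.2) + wnorm2 (wsp p sigma) (z.2 - c.2).
Proof.
move=> /(cross_le (z.1.1 - c.1)); rewrite /lyap /Vk ler_norml => /andP[+ _].
have := mulr_ge0 (ltW half_slack_gt0) (addr_ge0 (tau_enorm_ge0 (z.1.1 - c.1))
  (wnorm2_wsp_ge0 (z.2 - z.1.2))).
have := wnorm2_wsp_ge0 (z.2 - c.2).
by move: (dot _ _) (tau^-1 * _) (wnorm2 _ _) (wnorm2 _ _) => a b w1 w2; lra.
Qed.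

Lemma decr_ge z : spdhg_inv z ->
  (1 - gamma) / 2 * (tau^-1 * enorm (xnext z - z.1.1) ^+ 2
    + wnorm2 (wsp p sigma) (z.2 - z.1.2)) <= decr z.
Proof.
move=> /(cross_le (xnext z - z.1.1)); rewrite /decr /V ler_norml => /andP[+ _].
by move: (dot _ _) (tau^-1 * _) (wnorm2 _ _) => a b w1; lra.
Qed.

Lemma lyap_ge0 c z : spdhg_inv z -> 0 <= lyap c z.
Proof.
move=> /(lyap_ge c); apply: le_trans; apply: addr_ge0.
  by rewrite (mulr_ge0 (ltW half_slack_gt0))// addr_ge0 ?tau_enorm_ge0 ?wnorm2_wsp_ge0.
by rewrite mulr_ge0 ?invr_ge0 ?wnorm2_wsp_ge0.
Qed.

Lemma decr_ge0 z : spdhg_inv z -> 0 <= decr z.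
Proof.
move=> /decr_ge; apply: le_trans; rewrite (mulr_ge0 (ltW half_slack_gt0))//.
by rewrite addr_ge0 ?tau_enorm_ge0 ?wnorm2_wsp_ge0.
Qed.

(* The slack of [lyap_ge] in [y^k - y^(k-1)] is spent on the decrement: one step
   later its conditional mean controls the full update [yhat], not just the
   sampled block. *)
Definition full_lyap c z : R :=
  lyap c z - (1 - gamma) / 2 * wnorm2 (wsp p sigma) (z.2 - z.1.2).

Definition full_decr z : R :=
  (1 - gamma) / 2 * (tau^-1 * enorm (xnext z - z.1.1) ^+ 2 + wyhat z).

Lemma full_lyap_ge c z : spdhg_inv z ->
  (1 - gamma) / 2 * (tau^-1 * enorm (z.1.1 - c.1) ^+ 2)
  + 2^-1 * wnorm2 (wsp p sigma) (z.2 - c.2) <= full_lyap c z.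
Proof. by move=> /(lyap_ge c); rewrite /full_lyap; lra. Qed.

Lemma full_lyap_ge0 c z : spdhg_inv z -> 0 <= full_lyap c z.
Proof.
move=> /(full_lyap_ge c); apply: le_trans; apply: addr_ge0.
  by rewrite (mulr_ge0 (ltW half_slack_gt0))// tau_enorm_ge0.
by rewrite mulr_ge0 ?invr_ge0 ?wnorm2_wsp_ge0.
Qed.

Lemma wyhat_ge0 z : 0 <= wyhat z.
Proof. by apply: wnorm2_ge0 => i; rewrite invr_gt0. Qed.

Lemma full_decr_ge0 z : 0 <= full_decr z.
Proof.
rewrite /full_decr (mulr_ge0 (ltW half_slack_gt0))//.
by rewrite addr_ge0 ?tau_enorm_ge0 ?wyhat_ge0.
Qed.

(** The bound [decr_ge] pays back the term in [y^k - y^(k-1)] subtracted in [full_lyap c z]; the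
    term subtracted after the step has conditional mean [(1 - gamma) / 2 * wyhat z]. *)
Lemma full_lyap_decrease c z : spdhg_inv z -> primal_dual_sol f g A c ->
  \sum_j p j * full_lyap c (spdhg_step z j) <= full_lyap c z - full_decr z.
Proof.
move=> zI /lyap_decrease - /(_ z); have := decr_ge zI.
have -> : \sum_j p j * full_lyap c (spdhg_step z j) =
    \sum_j p j * lyap c (spdhg_step z j) - (1 - gamma) / 2 * wyhat z.
  rewrite -mean_wnorm2_step mulr_sumr -sumrB; apply: eq_bigr => j _.
  by rewrite /full_lyap mulrBr [in X in _ - X]mulrCA.
by rewrite /full_lyap /full_decr; move: (\sum_(j < n) (p j * _)) (wyhat z) => S w; lra.
Qed.

(** The constant is uniform in [c], as the center will vary with the realization and the
    accuracy. *)
Lemma full_lyap_coercive : exists2 K, 0 < K & forall c z, spdhg_inv z ->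
  enorm (z.1.1 - c.1) ^+ 2 <= K * full_lyap c z /\
  enorm (z.2 - c.2) ^+ 2 <= K * full_lyap c z.
Proof.
have k0 := half_slack_gt0; have ki0 : 0 < ((1 - gamma) / 2)^-1 by rewrite invr_gt0.
have S0 : 0 <= \sum_i (wsp p sigma i)^-1.
  by apply: sumr_ge0 => i _; rewrite invr_ge0 ltW// wsp_gt0.
exists (tau / ((1 - gamma) / 2) + 2 * \sum_i (wsp p sigma i)^-1).
  by rewrite ltr_wpDr ?mulr_ge0// mulr_gt0.
move=> c z zI; have L0 := full_lyap_ge0 c zI; have := full_lyap_ge c zI.
have x0 := mulr_ge0 (ltW k0) (tau_enorm_ge0 (z.1.1 - c.1)).
have := wnorm2_wsp_ge0 (z.2 - c.2); have := le_wnorm2 (z.2 - c.2) wsp_gt0.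
set w := wnorm2 _ _; set S := \sum_i _ in S0 *; move=> yw w0 L; split.
  apply: (@le_trans _ _ (tau / ((1 - gamma) / 2) * full_lyap c z)).
    rewrite -mulrA -ler_pdivrMl// -ler_pdivrMl ?invr_gt0// invrK.
    by lra.
  by rewrite ler_wpM2r// lerDl mulr_ge0.
apply: (le_trans yw); apply: (@le_trans _ _ (S * (2 * full_lyap c z))).
  by rewrite ler_wpM2l//; lra.
by rewrite mulrA (mulrC S) ler_wpM2r// lerDr mulr_ge0 ?(ltW htau)// ltW.
Qed.

Lemma full_lyap_upper : exists2 K, 0 < K & forall c z, spdhg_inv z ->
  full_lyap c z <= K * (enorm (z.1.1 - c.1) ^+ 2 + enorm (z.2 - z.1.2) ^+ 2
                    + enorm (z.2 - c.2) ^+ 2).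
Proof.
have S0 : 0 <= \sum_i wsp p sigma i by apply: sumr_ge0 => i _; rewrite ltW ?wsp_gt0.
have t0 : 0 < tau^-1 by rewrite invr_gt0.
exists (tau^-1 + \sum_i wsp p sigma i); first by rewrite ltr_wpDr.
move=> c z /(lyap_le c); rewrite /full_lyap.
have := wnorm2_le (z.2 - z.1.2) wsp_gt0; have := wnorm2_le (z.2 - c.2) wsp_gt0.
set S := \sum_i _ in S0 *.
have : 0 <= (1 - gamma) / 2 * wnorm2 (wsp p sigma) (z.2 - z.1.2).
  by rewrite mulr_ge0 ?divr_ge0 ?subr_ge0 ?(ltW hgamma1) ?wnorm2_ge0//; exact: wsp_gt0.
have := mulr_ge0 S0 (sqr_ge0 (enorm (z.1.1 - c.1))).
have := mulr_ge0 (ltW t0) (sqr_ge0 (enorm (z.2 - z.1.2))).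
have := mulr_ge0 (ltW t0) (sqr_ge0 (enorm (z.2 - c.2))).
lra.
Qed.

Lemma full_decr_coercive : exists2 K, 0 < K & forall z,
  enorm (xnext z - z.1.1) ^+ 2 <= K * full_decr z /\
  enorm (yhat z - z.2) ^+ 2 <= K * full_decr z.
Proof.
have k0 : 0 < (1 - gamma) / 2 by rewrite divr_gt0// subr_gt0.
have S0 : 0 <= \sum_i (sigma i)^-1^-1.
  by apply: sumr_ge0 => i _; rewrite !invr_ge0 ltW.
have si0 i : 0 < (sigma i)^-1 by rewrite invr_gt0.
exists ((tau + \sum_i (sigma i)^-1^-1) / ((1 - gamma) / 2)).
  by rewrite divr_gt0// ltr_wpDr.
move=> z; rewrite /full_decr mulrA divfK ?gt_eqF//.
have := wyhat_ge0 z; have := le_wnorm2 (yhat z - z.2) si0.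
rewrite -/(wyhat z); set S := \sum_i _ in S0 *; set a := enorm _ ^+ 2.
have a0 : 0 <= tau^-1 * enorm (xnext z - z.1.1) ^+ 2.
  by rewrite mulr_ge0 ?sqr_ge0// invr_ge0 ltW.
move=> aS w0; split.
  apply: (@le_trans _ _ (tau * (tau^-1 * enorm (xnext z - z.1.1) ^+ 2))).
    by rewrite mulrA divff ?mul1r// gt_eqF.
  by apply: ler_pM; rewrite ?(ltW htau)// lerDl.
by apply: (le_trans aS); rewrite ler_pM// ?lerDr// ltW.
Qed.

Lemma enorm_submxcol_le (y : Y) i : enorm (submxcol y i) <= enorm y.
Proof.
rewrite -(@ler_pXn2r _ 2)// ?nnegrE ?enorm_ge0// [leRHS]enorm_sqr_submxcol.
by rewrite (bigD1 i)//= lerDl; apply: sumr_ge0 => j _; exact: sqr_ge0.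
Qed.

Lemma enorm_spdhg_step z j :
  enorm ((spdhg_step z j).2 - z.2) <= enorm (yhat z - z.2).
Proof.
rewrite -(@ler_pXn2r _ 2)// ?nnegrE ?enorm_ge0// !enorm_sqr_submxcol.
apply: ler_sum => i _; rewrite !submxcolB /= mxcolK.
by case: ifP => // _; rewrite subrr enorm0 expr0n sqr_ge0.
Qed.

Lemma enorm_invP_le : exists2 B, 0 <= B & forall y : Y, enorm (invP p y) <= B * enorm y.
Proof.
have pi0 i : 0 <= (p i)^-1 by rewrite invr_ge0 ltW.
have S0 : 0 <= \sum_i (p i)^-1 by exact: sumr_ge0.
exists (\sum_i (p i)^-1) => // y.
rewrite -(@ler_pXn2r _ 2)// ?nnegrE ?mulr_ge0 ?enorm_ge0// exprMn !enorm_sqr_submxcol.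
rewrite mulr_sumr; apply: ler_sum => i _; rewrite mxcolK enormZ exprMn.
rewrite ler_wpM2r ?sqr_ge0// ger0_norm// lerXn2r ?nnegrE//.
by rewrite (bigD1 i)//= lerDl sumr_ge0.
Qed.

(** The inclusions of the proximal steps are the optimality conditions up to errors controlled by
    the residuals, so closedness of the graphs of the subdifferentials applies. *)
Lemma primal_dual_sol_closed (xs : X) (ys : Y) :
  (forall e, 0 < e -> exists z,
    [/\ enorm (z.1.1 - xs) < e, enorm (z.2 - ys) < e,
        enorm (xnext z - z.1.1) < e, enorm (yhat z - z.2) < e &
        enorm (z.2 - z.1.2) < e]) ->
  primal_dual_sol f g A (xs, ys).
Proof.
move=> near_sol; split=> /=.
  exists (- ((opA A)^T *m ys)); last by rewrite subrr.
  have [hgp hgl _] := hg; apply: subdiff_closed => // e e0.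
  have [BA BA0 hBA] := enorm_bounded_image (opA A)^T.
  have [BP BP0 hBP] := enorm_invP_le.
  have t0 : 0 < tau^-1 by rewrite invr_gt0.
  have AP0 : 0 <= BA * (1 + BP) by rewrite mulr_ge0// addr_ge0.
  (* The bounds [2 * r] on the error of the point and [(tau^-1 + BA * (1 + BP)) * r] on that of the
     subgradient add up to [e]. *)
  pose r := e / (2 + tau^-1 + BA * (1 + BP)).
  have D0 : 0 < 2 + tau^-1 + BA * (1 + BP) by lra.
  have r0 : 0 < r by rewrite divr_gt0.
  have rE : 2 * r + tau^-1 * r + BA * (1 + BP) * r = e.
    by rewrite -!mulrDl mulrC divfK// gt_eqF.
  have [z [zx zy xz yz dz]] := near_sol r r0.
  have tr0 := mulr_gt0 t0 r0; have APr0 := mulr_ge0 AP0 (ltW r0).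
  exists (xnext z), (tau^-1 *: (z.1.1 - xnext z)
      - (opA A)^T *m (z.2 + invP p (z.2 - z.1.2))); split.
  - by have := enorm_triangle z.1.1 (xnext z) xs; lra.
  - have -> : tau^-1 *: (z.1.1 - xnext z) - (opA A)^T *m (z.2 + invP p (z.2 - z.1.2))
        - - ((opA A)^T *m ys) = tau^-1 *: (z.1.1 - xnext z)
        - (opA A)^T *m (z.2 - ys + invP p (z.2 - z.1.2)).
      rewrite !mulmxDr mulmxN !opprD !opprK -!addrA.
      by congr (_ + (_ + _)); rewrite addrC.
    apply: le_lt_trans (enormD _ _) _; rewrite enormN enormZ gtr0_norm// enormBC.
    have H1 : tau^-1 * enorm (xnext z - z.1.1) < tau^-1 * r by rewrite ltr_pM2l.
    have H2 := hBA (z.2 - ys + invP p (z.2 - z.1.2)).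
    have H3 : BA * enorm (z.2 - ys + invP p (z.2 - z.1.2)) <= BA * ((1 + BP) * r).
      rewrite ler_wpM2l// (le_trans (enormD _ _))//.
      have : BP * enorm (z.2 - z.1.2) <= BP * r by rewrite ler_wpM2l// ltW.
      by have := hBP (z.2 - z.1.2); lra.
    lra.
  - exact: xnext_subdiff.
exists (opA A *m xs); last by rewrite subrr.
apply/subdiff_conjugate_sumf => // i; rewrite submxcol_opA.
have [hfp hfl _] := conjugate_closed_proper_convex (hf i).
apply: subdiff_closed => // e e0.
have [B B0 hB] := enorm_bounded_image (A i).
have si0 : 0 < (sigma i)^-1 by rewrite invr_gt0.
pose r := e / (2 + (sigma i)^-1 + 2 * B).
have D0 : 0 < 2 + (sigma i)^-1 + 2 * B by lra.
have r0 : 0 < r by rewrite divr_gt0.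
have rE : 2 * r + (sigma i)^-1 * r + 2 * B * r = e.
  by rewrite -!mulrDl mulrC divfK// gt_eqF.
have [z [zx zy xz yz _]] := near_sol r r0.
have sr0 := mulr_gt0 si0 r0; have Br0 := mulr_ge0 B0 (ltW r0).
exists (submxcol (yhat z) i), ((sigma i)^-1 *: (submxcol z.2 i - submxcol (yhat z) i)
  + A i *m xnext z); split.
- rewrite -submxcolB; apply: le_lt_trans (enorm_submxcol_le _ _) _.
  by have := enorm_triangle z.2 (yhat z) ys; lra.
- rewrite -addrA -mulmxBr -submxcolB.
  apply: le_lt_trans (enormD _ _) _; rewrite enormZ gtr0_norm//.
  have H1 : (sigma i)^-1 * enorm (submxcol (z.2 - yhat z) i) < (sigma i)^-1 * r.
    by rewrite ltr_pM2l// (le_lt_trans (enorm_submxcol_le _ _))// enormBC.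
  have H2 : B * enorm (xnext z - xs) <= B * (2 * r).
    by rewrite ler_wpM2l//; have := enorm_triangle z.1.1 (xnext z) xs; lra.
  by have := hB (xnext z - xs); lra.
- exact: yhat_subdiff.
Qed.

(** Summable decrements make the residuals vanish, so a cluster point of the bounded iterates is a
    solution. Centered there, [full_lyap] becomes arbitrarily small, which triggers the last
    hypothesis: the iterates eventually stay near some center. *)
Lemma spdhg_deterministic_limit (z : nat -> state) (j : nat -> 'I_n) :
  (forall k, spdhg_inv (z k)) -> (forall k, z k.+1 = spdhg_step (z k) (j k)) ->
  (exists c B, forall k, full_lyap c (z k) + \sum_(i < k) full_decr (z i) <= B) ->
  (forall lam, 0 < lam ->
    (forall delta, 0 < delta -> exists k c,
      primal_dual_sol f g A c /\ full_lyap c (z k) <= delta) ->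
    exists c K, forall k, (K <= k)%N -> full_lyap c (z k) < lam) ->
  exists xs ys, primal_dual_sol f g A (xs, ys) /\
    forall e, 0 < e -> exists N, forall k, (N <= k)%N ->
      enorm ((z k).1.1 - xs) < e /\ enorm ((z k).2 - ys) < e.
Proof.
move=> zI zS [c0 [B zB]] zrec.
have lt_of_sqr (t e : R) : 0 < e -> t ^+ 2 < e ^+ 2 -> t < e.
  by move=> e0; rewrite !expr2; nra.
have [K1 K10 hK1] := full_lyap_coercive.
have [K2 K20 hK2] := full_decr_coercive.
have [K3 K30 hK3] := full_lyap_upper.
have D0 k : 0 <= \sum_(i < k) full_decr (z i).
  by apply: sumr_ge0 => i _; exact: full_decr_ge0.
have small e : 0 < e -> exists N, forall k, (N <= k)%N ->
    enorm (xnext (z k) - (z k).1.1) < e /\ enorm (yhat (z k) - (z k).2) < e.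
  move=> e0; have e20 : 0 < e ^+ 2 / K2 by rewrite divr_gt0// exprn_gt0.
  have [||N hN] := @bounded_series_small _ (fun k => full_decr (z k)) B _ _ _ e20.
  - by move=> k; exact: full_decr_ge0.
  - by move=> k; apply: le_trans (zB k); rewrite lerDr full_lyap_ge0.
  exists N => k /hN; rewrite ltr_pdivlMr// mulrC => De.
  have [H1 H2] := hK2 (z k).
  by split; apply: lt_of_sqr => //; exact: le_lt_trans De.
(* The two components are stacked so that one cluster point serves both; [t <= t ^+ 2 + 1] turns
   bounds on squared distances into bounds on distances. *)
have bnd k : enorm (col_mx (z k).1.1 (z k).2) <=
    enorm c0.1 + enorm c0.2 + 2 + 2 * (K1 * B).
  have [H1 H2] := hK1 c0 _ (zI k).
  have LB : full_lyap c0 (z k) <= B by apply: le_trans (zB k); rewrite lerDl.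
  have {LB}LB : K1 * full_lyap c0 (z k) <= K1 * B by rewrite ler_pM2l.
  have := enormD ((z k).1.1 - c0.1) c0.1; have := enormD ((z k).2 - c0.2) c0.2.
  rewrite !subrK; have := enorm_col_mx_le (z k).1.1 (z k).2.
  have := sqr_ge0 (enorm ((z k).1.1 - c0.1) - 1).
  have := sqr_ge0 (enorm ((z k).2 - c0.2) - 1).
  have := sqr_ge0 (enorm ((z k).1.1 - c0.1)); have := sqr_ge0 (enorm ((z k).2 - c0.2)).
  lra.
have [v hv] := bolzano_weierstrass bnd.
set xs := usubmx v; set ys := dsubmx v.
have near_sol e N : 0 < e -> exists2 k, (N <= k)%N &
    [/\ enorm ((z k).1.1 - xs) < e, enorm ((z k).2 - ys) < e,
        enorm (xnext (z k) - (z k).1.1) < e, enorm (yhat (z k) - (z k).2) < e &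
        enorm ((z k).2 - (z k).1.2) < e].
  move=> e0; have [N1 hN1] := small e e0.
  (* The successor is there because [y^k - y^(k-1)] is bounded by the full dual update of the
     preceding state. *)
  have [k] := hv e (maxn N N1.+1) e0; rewrite geq_max => /andP[Nk N1k].
  have -> : col_mx (z k).1.1 (z k).2 - v = col_mx ((z k).1.1 - xs) ((z k).2 - ys).
    by rewrite -[v in LHS]vsubmxK opp_col_mx add_col_mx.
  move=> kv; have [xk yk] := hN1 k (ltnW N1k); exists k => //; split=> //.
  - exact: le_lt_trans (enorm_le_col_mxu _ _) kv.
  - exact: le_lt_trans (enorm_le_col_mxd _ _) kv.
  - case: k N1k {Nk kv xk yk} => // k N1k; rewrite zS /=.
    apply: le_lt_trans (enorm_spdhg_step _ _) _.
    by have [] := hN1 k N1k.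
have sol : primal_dual_sol f g A (xs, ys).
  apply: primal_dual_sol_closed => e e0.
  by have [k _ ?] := near_sol e 0%N e0; exists (z k).
exists xs, ys; split=> // e e0.
(* At this level [full_lyap_coercive] puts both components within [e / 3] of the center. *)
have lam0 : 0 < (e / 3) ^+ 2 / K1 by rewrite divr_gt0// exprn_gt0// divr_gt0.
have [|c [K hK]] := zrec _ lam0.
  move=> delta delta0; pose r := Num.min 1 (delta / (3 * K3)).
  have r0 : 0 < r by rewrite lt_min ltr01 divr_gt0// mulr_gt0.
  have [k _ [xk yk _ _ dk]] := near_sol r 0%N r0.
  exists k, (xs, ys); split=> //; apply: le_trans (hK3 (xs, ys) _ (zI k)) _.
  have rr (t : R) : 0 <= t -> t < r -> t ^+ 2 <= delta / (3 * K3).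
    move=> t0; rewrite lt_min => /andP[t1 tr]; rewrite expr2.
    by rewrite (le_trans _ (ltW tr))// ler_piMl// ltW.
  have := rr _ (enorm_ge0 _) xk; have := rr _ (enorm_ge0 _) yk.
  have := rr _ (enorm_ge0 _) dk => /= H1 H2 H3.
  rewrite -ler_pdivlMl// (le_trans (lerD (lerD H3 H1) H2))//.
  by rewrite le_eqVlt; apply/orP; left; apply/eqP; field; rewrite gt_eqF.
have e3 : 0 < e / 3 by rewrite divr_gt0.
have close k : (K <= k)%N ->
    enorm ((z k).1.1 - c.1) < e / 3 /\ enorm ((z k).2 - c.2) < e / 3.
  move=> /hK; rewrite ltr_pdivlMr// mulrC => Le; have [H1 H2] := hK1 c _ (zI k).
  by split; apply: lt_of_sqr => //; exact: le_lt_trans Le.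
(* The center depends on [e], so the limit remains the cluster point, which a late index [l] links
   to the center. *)
have [l Kl [xl yl _ _ _]] := near_sol _ K e3.
have [xlc ylc] := close l Kl.
exists K => k /close[xkc ykc]; split.
  have := enorm_triangle c.1 (z k).1.1 xs.
  have := enorm_triangle (z l).1.1 c.1 xs; rewrite (enormBC c.1 (z l).1.1); lra.
have := enorm_triangle c.2 (z k).2 ys.
by have := enorm_triangle (z l).2 c.2 ys; rewrite (enormBC c.2 (z l).2); lra.
Qed.

End Lyapunov.

(** * From a realization of the algorithm to the chain, and conclusion *)

Lemma spdhg_run_chain (R : realType) (n d : nat) (m : 'I_n -> nat)
  (f : forall i : 'I_n, 'cV[R]_(m i) -> \bar R) (g : 'cV[R]_d -> \bar R)
  (A : forall i : 'I_n, 'M[R]_(m i, d)) (p sigma : 'I_n -> R) (tau : R)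
  (x0 : 'cV[R]_d) (y0 : 'cV[R]_(\sum_i m i))
  (disp : measure_display) (Omega : measurableType disp)
  (s : nat -> Omega -> 'I_n) (w : Omega) x y ybar :
  spdhg_run f g A p sigma tau x0 y0 (s ^~ w) x y ybar ->
  forall k, chain s (spdhg_step f g A p sigma tau) (x0, y0, y0) k w =
    (x k, y k, y k.+1).
Proof.
move=> [x0E y0E y1E yb1E run].
(* The extrapolation formula also holds at index 1, where [y 1 = y 0] makes the increment vanish. *)
have ybarE k : ybar k.+1 = y k.+1 + invP p (y k.+1 - y k).
  case: k => [|k]; last by have [] := run k.+1 (ltn0Sn k).
  rewrite yb1E y1E y0E subrr (_ : invP p 0 = 0) ?addr0//.
  by apply/mxcolP => i; rewrite mxcolK !submxcol0 scaler0.
elim=> [|k IHk] /=; first by rewrite x0E y0E y1E.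
have [xE yE yE' _] := run k.+1 (ltn0Sn k).
have xkE : xnext g A p tau (x k, y k, y k.+1) = x k.+1.
  rewrite xE ybarE; reflexivity.
rewrite IHk /spdhg_step xkE /=; congr (_, _, _).
apply/mxcolP => i; rewrite mxcolK; case: eqVneq => [->|/yE' ->//].
by rewrite mxcolK xkE yE.
Qed.

Theorem theorem4p3 (R : realType) (n d : nat) (m : 'I_n -> nat)
  (f : forall i : 'I_n, 'cV[R]_(m i) -> \bar R) (g : 'cV[R]_d -> \bar R)
  (A : forall i : 'I_n, 'M[R]_(m i, d))
  (p sigma : 'I_n -> R) (tau gamma : R)
  (x0 : 'cV[R]_d) (y0 : 'cV[R]_(\sum_i m i))
  (disp : measure_display) (Omega : measurableType disp)
  (P : probability Omega R)
  (s : nat -> Omega -> 'I_n)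
  (x : nat -> Omega -> 'cV[R]_d)
  (y ybar : nat -> Omega -> 'cV[R]_(\sum_i m i))
  (hf : forall i, [/\ proper_fun (@f i), lower_semicontinuous (@f i) &
                      convex_efun (@f i)])
  (hg : [/\ proper_fun g, lower_semicontinuous g & convex_efun g])
  (hmin : exists u, forall v, (primal_obj f g A u <= primal_obj f g A v)%E)
  (hri : relint (dom_diff f g A) 0)
  (hp : forall i, 0 < p i) (hp1 : \sum_i p i = 1)
  (htau : 0 < tau) (hsigma : forall i, 0 < sigma i)
  (hgamma0 : 0 <= gamma) (hgamma1 : gamma < 1)
  (hstep : forall i,
    (p i)^-1 * tau * sigma i * opnorm (A i) ^+ 2 <= gamma ^+ 2)
  (hs : sampling P p s)
  (hrun : forall w, spdhg_run f g A p sigma tau x0 y0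
                      (s ^~ w) (x ^~ w) (y ^~ w) (ybar ^~ w)) :
  (forall (xs : 'cV[R]_d) (ys : 'cV[R]_(\sum_i m i)),
     primal_dual_sol f g A (xs, ys) ->
     (* y^1 = y^0 = y0 is deterministic *)
     let Delta0 := Vk A p sigma tau y0 y0 (x0 - xs) (y0 - ys) in
     (forall k : nat, (0 < k)%N ->
        ('E_P[fun w => Vk A p sigma tau (y k w) (y k.-1 w)
                         (x k.-1 w - xs)%R (y k w - ys)%R] <= Delta0%:E)%E) /\
     (\sum_(1 <= k <oo)
        'E_P[fun w => V A p sigma tau (x k w - x k.-1 w)%R
                               (y k w - y k.-1 w)%R]
        <= Delta0%:E)%E) /\
  {ae P, forall w, exists (xs : 'cV[R]_d) (ys : 'cV[R]_(\sum_i m i)),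
     [/\ primal_dual_sol f g A (xs, ys),
         x ^~ w @ \oo --> xs & y ^~ w @ \oo --> ys]}.
Proof.
have hf' i : closed_proper_convex (@f i).
  by have [? /lower_semicontinuous_enorm ? ?] := hf i.
have hg' : closed_proper_convex g.
  by have [? /lower_semicontinuous_enorm ? ?] := hg.
have p_ge0 j : 0 <= p j by exact: ltW.
pose step := spdhg_step f g A p sigma tau.
pose z0 : 'cV[R]_d * 'cV[R]_(\sum_i m i) * 'cV[R]_(\sum_i m i) := (x0, y0, y0).
have chainE w k : chain s step z0 k w = (x k w, y k w, y k.+1 w).
  exact: spdhg_run_chain (hrun w) k.
(* Probabilities summing to 1 force [n] to be positive; any index then witnesses that the initial
   increment 0 has a single block. *)
have [j0 _|n0] := pickP (xpredT : pred 'I_n); last first.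
  by exfalso; move: hp1; rewrite big_pred0// => /esym/eqP; rewrite oner_eq0.
have Inv0 : spdhg_inv z0.
  by exists j0 => i _; rewrite /= subrr submxcol0.
have InvS z j : spdhg_inv z -> spdhg_inv (step z j).
  by move=> _; exact: spdhg_step_inv.
split.
  move=> xs ys sol Delta0.
  have D0 z : spdhg_inv z -> 0 <= decr g A p sigma tau z.
    exact: (@decr_ge0 _ _ _ _ g A p sigma tau gamma hp htau hsigma hgamma0 hgamma1 hstep z).
  have dec k : mean_chain p step z0 k (lyap A p sigma tau (xs, ys))
      + \sum_(i < k) mean_chain p step z0 i (decr g A p sigma tau) <= Delta0.
    apply: (supermartingale_decrement_mean_chain p_ge0 Inv0 InvS) => z _.
    exact: lyap_decrease.
  have mean_chain_ge0 U k : (forall z, spdhg_inv z -> 0 <= U z) ->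
      0 <= mean_chain p step z0 k U.
    by move=> U0; rewrite -(mean_chain_cst hp1 step z0 k 0); exact: mean_chain_le U0.
  split=> [[//|k] _|].
    (* State [k] of the chain is [(x k, y k, y k.+1)], so it carries [V_(k+1)]. *)
    have -> : (fun w => Vk A p sigma tau (y k.+1 w) (y k w) (x k w - xs) (y k.+1 w - ys))
        = fun w => lyap A p sigma tau (xs, ys) (chain s step z0 k w).
      by apply/funext => w; rewrite chainE.
    rewrite (expectation_chain hs)// lee_fin; apply: le_trans (dec k).
    by rewrite lerDl sumr_ge0// => i _; exact: mean_chain_ge0.
  have EV k : ('E_P[fun w => V A p sigma tau (x k.+1 w - x k w) (y k.+1 w - y k w)]
      = (mean_chain p step z0 k (decr g A p sigma tau))%:E)%E.
    rewrite -(expectation_chain hs)//; congr expectation; apply/funext => w.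
    have /(congr1 (fun z => z.1.1)) xE := chainE w k.+1.
    rewrite [LHS]/= chainE in xE; rewrite /decr chainE.
    rewrite [xnext _ _ _ _ _]xE; reflexivity.
  apply: lime_le.
    apply: is_cvg_nneseries => -[//|k] _ _.
    by rewrite EV lee_fin mean_chain_ge0.
  have lyap0 k : 0 <= mean_chain p step z0 k (lyap A p sigma tau (xs, ys)).
    apply: mean_chain_ge0 => z.
    exact: (lyap_ge0 hp htau hsigma hgamma0 hgamma1 hstep).
  apply: nearW => -[|N].
    rewrite big_geq// lee_fin; apply: le_trans (lyap0 0%N) (le_trans _ (dec 0%N)).
    by rewrite lerDl sumr_ge0// => i _; exact: mean_chain_ge0.
  rewrite big_add1 big_mkord (eq_bigr _ (fun (i : 'I_N) _ => EV i)) sumEFin lee_fin.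
  by apply: le_trans (dec N); rewrite lerDr.
have [c0 sol0] := primal_dual_sol_exists hf' hg' hmin hri.
(* Centers form a subtype because the drift inequality is available at primal-dual solutions. *)
pose C := {c | primal_dual_sol f g A c}.
pose M (c : C) z := full_lyap A p sigma tau gamma (sval c) z.
pose D z := full_decr f g A p sigma tau gamma z.
have M0 (c : C) z : spdhg_inv z -> 0 <= M c z.
  exact: (full_lyap_ge0 hp htau hsigma hgamma0 hgamma1 hstep).
have D0 z : spdhg_inv z -> 0 <= D z by move=> _; exact: full_decr_ge0.
have MD (c : C) z : spdhg_inv z -> \sum_j p j * M c (step z j) <= M c z - D z.
  by move=> zI; apply: full_lyap_decrease => //; exact: (svalP c).
have bounded := ae_bounded_supermartingale hs p_ge0 hp1 Inv0 InvS M0 D0 MD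
  (exist _ c0 sol0 : C).
(* Countably many levels [i.+1%:R^-1] suffice, and their exceptional events together remain
   negligible. *)
have recurrent : {ae P, forall w, forall i : nat,
    (forall delta, 0 < delta -> exists k c, M c (chain s step z0 k w) <= delta) ->
    exists c K, forall k, (K <= k)%N -> M c (chain s step z0 k w) < i.+1%:R^-1}.
  apply/ae_foralln => i.
  apply: (ae_recurrent_supermartingale hs p_ge0 hp1 Inv0 InvS M0 D0 MD).
  by rewrite invr_gt0.
near=> w.
have wB : exists B, forall k, M (exist _ c0 sol0 : C) (chain s step z0 k w)
    + \sum_(i < k) D (chain s step z0 i w) <= B by near: w.
have wR : forall i : nat,
    (forall delta, 0 < delta -> exists k c, M c (chain s step z0 k w) <= delta) ->
    exists c K, forall k, (K <= k)%N -> M c (chain s step z0 k w) < i.+1%:R^-1 by near: w.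
have [|||xs [ys [sol zlim]]] := @spdhg_deterministic_limit _ _ _ _ f g A p sigma tau gamma
  hf' hg' hp htau hsigma hgamma0 hgamma1 hstep (fun k => chain s step z0 k w)
  (fun k => s k.+1 w) _ (fun k => erefl).
- by move=> k; exact: Inv_chain.
- by have [B hB] := wB; exists c0, B.
- move=> lam lam0 rec.
  have [i _ /(_ i (leqnn i)) ilam] := near_infty_natSinv_lt (PosNum lam0).
  have [|c [K hK]] := wR i.
    by move=> delta /rec[k [c [solc hc]]]; exists k, (exist _ c solc).
  by exists (sval c), K => k /hK /lt_trans; apply.
exists xs, ys; split=> //; apply: cvg_enorm => e /zlim[N hN].
  by exists N => k /hN[]; rewrite chainE.
(* The chain at index [k] holds [y k.+1], hence the shift by one. *)
exists N.+1 => -[//|k] /hN[_]; rewrite chainE.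
by [].
Unshelve. all: by end_near.
Qed.
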